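(* Let $1\le p<q<\infty$ and for each $n$ let $Z=Z_n$ be uniformly distributed in $\mathbb B_p^n$. Then $(n^{1/p-1/q}\|Z\|_q)_{n\in\mathbb N}$ satisfies an LDP on $\mathbb R$ with speed $n^{p/q}$ and good rate function \[ \mathcal I(z)=\begin{cases}\frac1p\big(z^q-M_p(q)\big)^{p/q} & z\ge M_p(q)^{1/q},\\ +\infty & \text{otherwise}.\end{cases} \]
   Context: $\|x\|_p=(\sum_i|x_i|^p)^{1/p}$, $\mathbb B_p^n=\{x\in\mathbb R^n:\|x\|_p\le1\}$, $M_p(q)=\frac{p^{q/p}}{q+1}\frac{\Gamma(1+\frac{q+1}{p})}{\Gamma(1+\frac1p)}$. A sequence of real random variables $(X_n)$ satisfies a large deviation principle (LDP) with speed $s(n)\to\infty$ and rate function $\mathcal I:\mathbb R\to[0,\infty]$ (lower semicontinuous) if for every Borel set $A$: $-\inf_{A^\circ}\mathcal I\le\liminf\frac1{s(n)}\log P(X_n\in A)\le\limsup\frac1{s(n)}\log P(X_n\in A)\le-\inf_{\overline A}\mathcal I$; it is good if its level sets are compact. *)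

(* Defs.v *)
From HB Require Import structures.
From mathcomp Require Import all_boot all_order all_algebra.
From mathcomp Require Import all_classical all_reals all_analysis.
Set Implicit Arguments. Unset Strict Implicit. Unset Printing Implicit Defensive.
Import Order.TTheory GRing.Theory Num.Theory.
Import numFieldNormedType.Exports.
Local Open Scope classical_set_scope.
Local Open Scope ring_scope.

Section defs.
Variable R : realType.

(* n-dimensional Lebesgue measure on R^n = n.-tuple R, defined by iterated
   (Tonelli) integration against the 1-dimensional Lebesgue measure:
   vol_0 A = 1_A(()),  vol_{n+1} A = \int vol_n (slice of A at x) dx. *)
Fixpoint vol (n : nat) : set (n.-tuple R) -> \bar R :=
  match n return set (n.-tuple R) -> \bar R with
  | 0 => fun A => (\1_A [tuple] : R)%:E
  | m.+1 => fun A =>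
      (\int[@lebesgue_measure R]_x vol [set t : m.-tuple R | A (cons_tuple x t)])%E
  end.

Definition lpnorm (p : R) (n : nat) (x : n.-tuple R) : R :=
  (\sum_(i < n) `|tnth x i| `^ p) `^ p^-1.

Definition lpball (p : R) (n : nat) : set (n.-tuple R) :=
  [set x | lpnorm p x <= 1].

Definition unif_ball_prob (p : R) (n : nat) (E : set (n.-tuple R)) : R :=
  fine (vol (@lpball p n `&` E)) / fine (vol (@lpball p n)).

Definition Gamma (s : R) : R :=
  fine (\int[@lebesgue_measure R]_(t in `[0%R, +oo[) ((t `^ (s - 1)) * expR (- t))%:E)%E.

Definition Mp (p q : R) : R :=
  p `^ (q / p) / (q + 1) * Gamma (1 + (q + 1) / p) / Gamma (1 + p^-1).

Definition LDP (law : nat -> set R -> R) (s : nat -> R) (I : R -> \bar R) : Prop :=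
  (forall x, (0 <= I x)%E) /\ lower_semicontinuous I /\
  forall A : set R, measurable A ->
    let u := (fun n => ((s n)^-1)%:E * lne ((law n A)%:E))%E in
    [/\ (- ereal_inf (I @` (interior A)) <= limn_einf u)%E,
        (limn_einf u <= limn_esup u)%E &
        (limn_esup u <= - ereal_inf (I @` (closure A)))%E].

Definition good_rate (I : R -> \bar R) : Prop :=
  forall a : R, compact [set x | (I x <= a%:E)%E].

End defs.
Arguments lpball {R} p n.

(* Main.v *)
(* Rescale Z to be uniform in the ball of radius n^(1/p), where the statistic becomes
   (S / n)^(1/q) with S = |y_1|^q + ... + |y_n|^q. Comparing this ball with the product
   density exp(- ||y||_p^p / p), the uniform law is at most a polynomial factor times the
   law of i.i.d. p-Gaussian coordinates, whose q-th absolute moment is M = Mp p q. The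
   polynomial factor is negligible at speed n^(p/q).

   Upper bound: S <= n (M - e) has probability exp(- c n) by a Chernoff bound. As |y_i|^q
   has a stretched exponential tail of index p/q < 1, the event S >= n (M + b) either has
   one coordinate with |y_i|^q > x = n b, which costs exp(- x^(p/q) / p), or has all
   |y_i|^q <= x, where a Chernoff bound for the truncated variables with slope
   x^(p/q - 1) / p gives the same cost. Hence also S / n -> M in probability.

   Lower bound: let one coordinate satisfy |y_1|^q ~ n b; the slice of the ball is a ball
   with n - (n b)^(p/q) in place of n, on which the other coordinates are typical, and the
   loss of volume is (1 - (n b)^(p/q) / n)^(n/p) ~ exp(- (n b)^(p/q) / p). *)
Require Import Defs.
From HB Require Import structures.
From mathcomp Require Import all_boot all_order all_algebra.
From mathcomp Require Import all_classical all_reals all_analysis.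
From mathcomp Require Import measurable_realfun ring lra.
Set Implicit Arguments. Unset Strict Implicit. Unset Printing Implicit Defensive.
Import Order.TTheory GRing.Theory Num.Theory.
Import numFieldNormedType.Exports.
Local Open Scope classical_set_scope.
Local Open Scope ring_scope.


(** * The iterated integral [vol] as a product measure *)

(** The comparison with the p-Gaussian law is one-sided: it bounds uniform probabilities only from
    above. The lower bound therefore compares ball volumes in dimensions n and n + 1 directly, and
    takes from the upper bounds only that typical sets have probability at least 1/2.

    The obstacle in the upper tail is that |y|^q has no exponential moment, since q > p. Even after
    truncation the critical tilt exp(|y|^p / p) cancels the density completely and leaves nothing
    integrable. A fraction d of the exponent is therefore kept back: it makes the tilted integrals
    finite, costs a factor 1 - d in the rate, and is made small before n grows. Truncating at x = n
    b makes the single-jump term and the truncated Chernoff term cost the same.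

    Deviations to the left cost exp(- c n), which is beyond every multiple of the speed because p /
    q < 1; this is why the rate is infinite below M^(1/q). *)

Section vol_measure.
Context {R : realType}.
Local Notation leb := (@lebesgue_measure R).

Definition cons_pair m (z : R * m.-tuple R) : m.+1.-tuple R := cons_tuple z.1 z.2.

Lemma measurable_cons_pair m : measurable_fun setT (@cons_pair m).
Proof. exact: measurable_cons. Qed.

Lemma vol0E : @vol R 0 = dirac ([tuple] : 0.-tuple R).
Proof. by []. Qed.

Lemma volSE m : @vol R m.+1 =
  fun A => (leb \x @vol R m)%E ((@cons_pair m) @^-1` A).
Proof.
apply/funext => A; rewrite /product_measure1 /=.
apply: eq_integral => x _ /=; congr (vol _).
by apply/seteqP; split => t; rewrite /xsection/= inE.
Qed.

Lemma vol_ge0 m (A : set (m.-tuple R)) : (0 <= vol A)%E.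
Proof.
elim: m A => [|m IH] A; first by rewrite vol0E.
by apply: integral_ge0 => x _; exact: IH.
Qed.

Lemma vol_set0 m : @vol R m set0 = 0%E.
Proof.
elim: m => [|m IH]; first by rewrite vol0E measure0.
by rewrite /= integral0_eq.
Qed.

(** The two properties need a joint induction: additivity in dimension m + 1 comes from a product
    measure, whose second factor must already be a sigma-finite measure. *)
Lemma vol_sigma m : semi_sigma_additive (@vol R m) /\ sigma_finite setT (@vol R m).
Proof.
elim: m => [|m [sa sf]].
  by rewrite vol0E; split; [exact: measure_semi_sigma_additive|exact: sigma_finiteT].
pose M := isMeasure.Build _ _ _ (@vol R m) (vol_set0 m) (@vol_ge0 m) sa.
pose mm : {measure set (m.-tuple R) -> \bar R} := HB.pack (@vol R m) M.
pose SF := Measure_isSigmaFinite.Build _ _ _ (mm : set _ -> \bar R) sf.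
pose mu : {sigma_finite_measure set (m.-tuple R) -> \bar R} :=
  HB.pack (@vol R m) M SF.
have E A : vol A = (leb \x mu)%E ((@cons_pair m) @^-1` A) by rewrite volSE.
have mp A : measurable A -> measurable (@cons_pair m @^-1` A).
  by move=> mA; rewrite -[X in measurable X]setTI; exact: measurable_cons_pair.
split.
  move=> F mF tF mUF.
  have H := @measure_semi_sigma_additive _ _ _ (leb \x mu)%E (fun k => @cons_pair m @^-1` (F k)).
  rewrite E preimage_bigcup.
  under [X in X @ _ --> _]eq_fun do under eq_bigr do rewrite E.
  apply: H => //.
  - by move=> i; exact: mp.
  - move=> i j _ _ [z [zi zj]]; apply: (tF i j) => //; by exists (cons_pair z).
  - by rewrite -preimage_bigcup; exact: mp.
have /sigma_finiteP[F [TF ndF Foo]] := sigma_finiteT leb.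
have /sigma_finiteP[G [TG ndG Goo]] := sigma_finiteT mu.
(* Left inverse of [cons_pair]; it carries the exhaustion of the product by boxes back to tuples. *)
pose f (t : m.+1.-tuple R) : R * m.-tuple R := (thead t, [tuple of behead t]).
have mf : measurable_fun setT f.
  apply/measurable_fun_pairP; split.
    rewrite (_ : _ \o _ = (fun t : m.+1.-tuple R => tnth t ord0))//.
    exact: measurable_tnth.
  exact: measurable_behead.
have cf : cancel (@cons_pair m) f.
  move=> [x t]; rewrite /f /cons_pair /=; congr (_, _).
  by apply/val_inj.
exists (fun k => f @^-1` (F k `*` G k)).
  apply/esym/seteqP; split => // t _.
  have [/= i _ Fi] : (\bigcup_n F n) (f t).1 by rewrite -TF.
  have [/= j _ Gj] : (\bigcup_n G n) (f t).2 by rewrite -TG.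
  exists (maxn i j) => //; split.
    by have /subsetPset := ndF _ _ (leq_maxl i j); exact.
  by have /subsetPset := ndG _ _ (leq_maxr i j); exact.
move=> k; have [mF Fk] := Foo k; have [mG Gk] := Goo k; split.
  by rewrite -[X in measurable X]setTI; apply: mf => //; exact: measurableX.
rewrite E (_ : _ @^-1` _ = F k `*` G k); last first.
  by apply/seteqP; split => z; rewrite /preimage /mkset cf.
by rewrite product_measure1E// lte_mul_pinfty// ge0_fin_numE.
Qed.

HB.instance Definition _ m := isMeasure.Build _ _ _ (@vol R m) (vol_set0 m)
  (@vol_ge0 m) (vol_sigma m).1.
HB.instance Definition _ m := Measure_isSigmaFinite.Build _ _ _ (@vol R m)
  (vol_sigma m).2.

End vol_measure.

(** * Tonelli, product bounds and scaling for the volume *)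

Section vol_theory.
Context {R : realType}.
Local Notation leb := (@lebesgue_measure R).

Lemma measurable_preimage_cons_pair m (A : set (m.+1.-tuple R)) :
  measurable A -> measurable (@cons_pair R m @^-1` A).
Proof.
by move=> mA; rewrite -[X in measurable X]setTI; exact: measurable_cons_pair.
Qed.

Lemma vol_cons m (A : set (m.+1.-tuple R)) :
  vol A = (\int[leb]_x vol [set t : m.-tuple R | A (cons_tuple x t)])%E.
Proof. by []. Qed.

Lemma measurable_slice m (A : set (m.+1.-tuple R)) x :
  measurable A -> measurable [set t : m.-tuple R | A (cons_tuple x t)].
Proof.
move=> mA; rewrite (_ : [set _ | _] = xsection (@cons_pair R m @^-1` A) x).
  by apply: measurable_xsection; exact: measurable_preimage_cons_pair.
by apply/seteqP; split => t; rewrite /xsection/= inE.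
Qed.

Lemma measurable_fun_slice m (A : set (m.+1.-tuple R)) : measurable A ->
  measurable_fun setT
    (fun x : R => (vol [set t : m.-tuple R | A (cons_tuple x t)])%E).
Proof.
move=> mA.
have := measurable_fun_xsection (@vol R m) (measurable_preimage_cons_pair mA).
congr (measurable_fun _ _); apply/funext => x /=; congr (vol _).
by apply/seteqP; split => t; rewrite /xsection/= inE.
Qed.

Lemma integral_vol_cons m (g : m.+1.-tuple R -> \bar R) :
  measurable_fun setT g -> (forall t, (0 <= g t)%E) ->
  (\int[@vol R m.+1]_t g t =
   \int[leb]_x \int[@vol R m]_t g (cons_tuple x t))%E.
Proof.
move=> mg g0.
have -> : (\int[@vol R m.+1]_t g t =
  \int[pushforward (leb \x @vol R m)%E (@cons_pair R m)]_t g t)%E.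
  apply: eq_measure_integral; first exact: measurable_cons_pair.
  by move=> mc A mA _; exact: (congr1 (@^~ A) (volSE m)).
rewrite ge0_integral_pushforward//; last exact: measurable_cons_pair.
rewrite preimage_setT fubini_tonelli1//=.
by apply: measurableT_comp => //; exact: measurable_cons_pair.
Qed.

Lemma measurable_prod_tnth m (f : nat -> R -> R) :
  (forall i, measurable_fun setT (f i)) ->
  measurable_fun setT (fun t : m.-tuple R => \prod_(i < m) f i (tnth t i)).
Proof.
move=> mf; apply: measurable_prod => i _.
by apply: measurableT_comp => //; exact: measurable_tnth.
Qed.

Lemma integral_vol_prod m (f : nat -> R -> R) (c : nat -> R) :
  (forall i, measurable_fun setT (f i)) -> (forall i x, 0 <= f i x) ->
  (forall i, \int[leb]_x (f i x)%:E = (c i)%:E)%E ->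
  (\int[@vol R m]_t (\prod_(i < m) f i (tnth t i))%:E = (\prod_(i < m) c i)%:E)%E.
Proof.
elim: m f c => [|m IH] f c mf f0 fc.
  under eq_integral do rewrite big_ord0.
  by rewrite big_ord0 integral_cst// mul1e/= indicE in_setT.
have c0 i : 0 <= c i by rewrite -lee_fin -fc; apply: integral_ge0 => x _; rewrite lee_fin.
rewrite integral_vol_cons; last first.
- by move=> t; rewrite lee_fin prodr_ge0.
- by apply/measurable_EFinP; exact: measurable_prod_tnth.
rewrite big_ord_recl/= mulrC EFinM -fc -ge0_integralZl//; last 3 first.
- by apply/measurable_EFinP; exact: mf.
- by move=> x _; rewrite lee_fin.
- by rewrite lee_fin prodr_ge0.
apply: eq_integral => x _.
rewrite muleC -(IH (fun i => f i.+1) (fun i => c i.+1))//.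
rewrite -ge0_integralZl//; last 3 first.
- by apply/measurable_EFinP; exact: (@measurable_prod_tnth m (fun i => f i.+1)).
- by move=> t _; rewrite lee_fin prodr_ge0.
- by rewrite lee_fin.
apply: eq_integral => t _; rewrite big_ord_recl EFinM; congr (_ * _)%E.
by congr EFin; apply: eq_bigr => i _; rewrite tnthS.
Qed.

(** Markov's inequality against a product function: the indicator of [A] is dominated by a multiple
    of a product, whose integral factorizes. Every Chernoff bound below is an instance. *)
Lemma vol_le_prod m (A : set (m.-tuple R)) (C : R) (f : nat -> R -> R) (c : nat -> R) :
  measurable A -> 0 <= C ->
  (forall i, measurable_fun setT (f i)) -> (forall i x, 0 <= f i x) ->
  (forall i, \int[leb]_x (f i x)%:E = (c i)%:E)%E ->
  (forall t, A t -> 1 <= C * \prod_(i < m) f i (tnth t i)) ->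
  (vol A <= (C * \prod_(i < m) c i)%:E)%E.
Proof.
move=> mA C0 mf f0 fc Af.
have -> : vol A = (\int[@vol R m]_t (\1_A t)%:E)%E by rewrite integral_indic ?setIT.
rewrite EFinM -(integral_vol_prod _ mf f0 fc).
rewrite -ge0_integralZl//; last 2 first.
- by apply/measurable_EFinP; exact: measurable_prod_tnth.
- by move=> t _; rewrite lee_fin prodr_ge0.
apply: ge0_le_integral => //.
- exact/measurable_EFinP/measurable_indic.
- by apply: measurable_funeM; apply/measurable_EFinP; exact: measurable_prod_tnth.
- move=> t _; rewrite indicE -EFinM lee_fin.
  case: (boolP (t \in A)) => [/set_mem/Af//|_].
  by rewrite mulr_ge0// prodr_ge0.
Qed.

Definition scale_tuple m (r : R) (t : m.-tuple R) : m.-tuple R :=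
  map_tuple ( *%R r) t.

Lemma measurable_scale_tuple m r : measurable_fun setT (@scale_tuple m r).
Proof.
apply/measurable_fun_tnthP => i.
rewrite (_ : _ \o _ = (fun t : m.-tuple R => r * tnth t i)).
  by apply: measurable_funM => //; exact: measurable_tnth.
by apply/funext => t /=; rewrite tnth_map.
Qed.

Lemma ge0_integral_scale (r : R) (h : R -> \bar R) : 0 < r ->
  measurable_fun setT h -> (forall x, 0 <= h x)%E ->
  (\int[leb]_x h (r * x)%R = r^-1%:E * \int[leb]_x h x)%E.
Proof.
move=> r0 mh h0.
have mr : measurable_fun (setT : set (measurableTypeR R)) ( *%R r : _ -> measurableTypeR R).
  exact: measurable_funM.
transitivity (\int[pushforward leb ( *%R r : _ -> measurableTypeR R)]_x h x)%E.
  by rewrite ge0_integral_pushforward// preimage_setT.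
have ri : 0 <= r^-1 by rewrite invr_ge0 ltW.
rewrite -(@ge0_integral_mscale _ _ _ leb setT measurableT (NngNum ri))//.
apply: eq_measure_integral => A mA _.
(* The image of Lebesgue measure under multiplication by [r], weighted by [r], gives each interval
   its length, so uniqueness identifies it with Lebesgue measure. *)
pose mu : {measure set (measurableTypeR R) -> \bar R} :=
  mscale (NngNum (ltW r0)) (pushforward leb ( *%R r : _ -> measurableTypeR R)).
have E B : measurable B -> leb B = (r%:E * leb (( *%R r : _ -> measurableTypeR R) @^-1` B))%E.
  apply: (@lebesgue_measure_unique R (mu mr)) => _ [[a b]] _ <-.
  rewrite /mu/= /mscale/= /pushforward/=.
  rewrite (_ : _ @^-1` _ = `](r^-1 * a), (r^-1 * b)]%classic); last first.
    by apply/seteqP; split => x /=; rewrite !in_itv/= ler_pdivlMl// ltr_pdivrMl.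
  rewrite !lebesgue_measure_itv/= !lte_fin ltr_pM2l ?invr_gt0//.
  case: ifPn => _; last by rewrite mule0.
  by rewrite -!EFinD -EFinM -mulrBr mulrA divff ?mul1r// gt_eqF.
rewrite /= /mscale/= /pushforward [in RHS]E// muleA -EFinM mulVf ?mul1e//.
by rewrite gt_eqF.
Qed.

Lemma vol_scale m (r : R) (A : set (m.-tuple R)) : 0 < r -> measurable A ->
  vol [set t | A (scale_tuple r t)] = ((r^-1 ^+ m)%:E * vol A)%E.
Proof.
move=> r0; elim: m A => [|m IH] A mA.
  rewrite expr0 mul1e; congr (vol _); apply/seteqP.
  by split => t /=; rewrite (tuple0 (scale_tuple r t)) (tuple0 t).
rewrite vol_cons.
transitivity (\int[leb]_x ((r^-1 ^+ m)%:E *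
    vol [set t : m.-tuple R | A (cons_tuple (r * x)%R t)]))%E.
  apply: eq_integral => x _; rewrite -IH; last exact: measurable_slice.
  congr (vol _); apply/seteqP; split => t /=.
    by rewrite (_ : scale_tuple r _ = cons_tuple (r * x) (scale_tuple r t))//; apply/val_inj.
  by rewrite (_ : scale_tuple r (cons_tuple x t) = cons_tuple (r * x) (scale_tuple r t))//; apply/val_inj.
rewrite ge0_integralZl//; last 2 first.
- have := measurable_fun_slice mA => mf.
  by apply: (measurableT_comp mf); exact: measurable_funM.
- by rewrite lee_fin exprn_ge0// invr_ge0 ltW.
rewrite (ge0_integral_scale r0 (measurable_fun_slice mA)); last first.
  by move=> x; exact: vol_ge0.
by rewrite vol_cons muleA -EFinM -exprSr.
Qed.

End vol_theory.

(** * One-dimensional integrals and the constant [Mp] *)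

Section one_dim.
Context {R : realType}.
Local Notation leb := (@lebesgue_measure R).

Lemma ge0_integral_even (f : R -> \bar R) : measurable_fun setT f ->
  (forall x, 0 <= f x)%E -> (forall x, f (- x) = f x) ->
  (\int[leb]_x f x = 2%:E * \int[leb]_(x in `[0%R, +oo[) f x)%E.
Proof.
move=> mf f0 fN.
have E : (\int[leb]_(x in `[0%R, +oo[) f x = \int[leb]_(x in `]-oo, 0%R]) f x)%E.
  by rewrite ge0_integration_by_substitution0//; apply: eq_integral => x _; rewrite fN.
rewrite -(setUv `]-oo, 0%R]%classic) ge0_integral_setU//=; last 3 first.
- exact: measurableC.
- by apply: measurable_funS mf.
- exact/disj_setPCl.
rewrite setCitvl -E mule_natl mule2n; congr (_ + _)%E.
by rewrite -integral_itv_obnd_cbnd//; exact: measurable_funS mf.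
Qed.

Lemma integral_expRN (u : R) :
  (\int[leb]_(t in `[u, +oo[) (expR (- t))%:E = (expR (- u))%:E)%E.
Proof.
have cE : continuous (fun t : R => expR (- t)).
  by move=> x; apply: continuous_comp; [exact: opp_continuous|exact: continuous_expR].
rewrite (@ge0_continuous_FTC2y _ _ (fun t => - expR (- t)) _ 0)//.
- by rewrite EFinN oppeK add0e.
- exact: continuous_subspaceT.
- by rewrite -oppr0; apply: cvgN; exact: cvgr_expR.
- by apply: cvgN; apply/cvg_at_right_filter; exact: cE.
- move=> x _; rewrite derive1E derive_val.
  by rewrite mulrN1 opprK.
Qed.

Lemma continuous_powR (a x : R) : 0 < x -> {for x, continuous (@powR R ^~ a)}.
Proof.
move=> x0; apply: differentiable_continuous; apply/derivable1_diffP.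
by apply: derivable_powR; rewrite in_itv/= x0.
Qed.

Lemma cvg_powR0 (a : R) : 0 <= a -> x `^ a @[x --> 0^'+] --> (0 : R) `^ a.
Proof.
rewrite le_eqVlt => /predU1P[<-|a0].
  by rewrite powRr0; under eq_cvg do rewrite powRr0; exact: cvg_cst.
by rewrite powR0 ?gt_eqF//; exact: powR_cvg0.
Qed.

Lemma integral_powR (a T : R) : 0 <= a -> 0 <= T ->
  (\int[leb]_(x in `[0%R, T]) (x `^ a)%:E = (T `^ (a + 1) / (a + 1))%:E)%E.
Proof.
move=> a0; have a1 : 0 < a + 1 by rewrite ltr_wpDl.
rewrite le_eqVlt => /predU1P[<-|T0].
  by rewrite set_itv1 integral_set1 powR0 ?gt_eqF// mul0r.
rewrite (@continuous_FTC2 _ _ (fun x => x `^ (a + 1) / (a + 1)))//.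
- by rewrite powR0 ?gt_eqF// mul0r sube0.
- apply/(continuous_within_itvP _ T0); split.
  + by move=> x; rewrite in_itv/= => /andP[x0 _]; exact: continuous_powR.
  + exact: cvg_powR0.
  + by apply/cvg_at_left_filter; exact: continuous_powR.
- split.
  + move=> x; rewrite in_itv/= => /andP[x0 _]; apply: derivableM => //.
    by apply: derivable_powR; rewrite in_itv/= x0.
  + apply: cvgM; last exact: cvg_cst.
    by apply: cvg_powR0; exact: ltW.
  + apply: cvgM; last exact: cvg_cst.
    by apply/cvg_at_left_filter; exact: continuous_powR.
- move=> x; rewrite in_itv/= => /andP[x0 _].
  rewrite derive1Mr; last by apply: derivable_powR; rewrite in_itv/= x0.
  rewrite powR_derive1 ?in_itv/= ?x0// addrK.
  by rewrite mulrAC divff ?mul1r// gt_eqF.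
Qed.

(* Tonelli on the region [{(y, t) | 0 <= y, y ^ p <= t}] with weight [y ^ a * exp (- t)]. *)
Lemma integral_Gamma_powR (p a : R) : 0 < p -> 0 <= a ->
  (\int[leb]_(t in `[0%R, +oo[) ((t `^ ((a + 1) / p) * expR (- t))%:E) =
   (a + 1)%:E * \int[leb]_(y in `[0%R, +oo[) ((y `^ a * expR (- (y `^ p)))%:E))%E.
Proof.
move=> p0 a0; have a1 : 0 < a + 1 by rewrite ltr_wpDl.
pose S (z : R * R) := (0 <= z.1) && (z.1 `^ p <= z.2).
have [K KE] : exists K : R * R -> \bar R,
    forall z, K z = (if S z then z.1 `^ a * expR (- z.2) else 0)%:E by eexists.
have mp r : measurable_fun setT (fun z : R * R => z.1 `^ r).
  by apply: (measurableT_comp (measurable_powR r)).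
have mK : measurable_fun setT K.
  rewrite (funext KE); apply/measurable_EFinP; apply: measurable_fun_ifT => //.
  - apply: measurable_and.
    + by apply: measurable_fun_ler => //; exact: measurable_fst.
    + by apply: measurable_fun_ler.
  - apply: measurable_funM => //.
    by apply: measurableT_comp => //; apply: measurableT_comp.
have K0 z : (0 <= K z)%E.
  by rewrite KE lee_fin; case: ifP => // _; rewrite mulr_ge0// ?powR_ge0// expR_ge0.
have FT := fubini_tonelli (m1 := leb) (m2 := leb) K mK K0.
have E1 : (\int[leb]_y \int[leb]_t K (y, t) =
  \int[leb]_(y in `[0%R, +oo[) ((y `^ a * expR (- (y `^ p)))%:E))%E.
  rewrite [RHS]integral_mkcond; apply: eq_integral => y _; rewrite patchE.
  case: ifPn => [|]; rewrite ?inE ?notin_setE/= in_itv/= andbT => y0.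
    transitivity (\int[leb]_(t in `[(y `^ p)%R, +oo[) ((y `^ a)%:E * (expR (- t))%:E))%E; last first.
      rewrite ge0_integralZl.
      - by rewrite integral_expRN EFinM.
      - exact: measurable_itv.
      - apply/measurable_EFinP; apply: measurable_funTS.
        by apply: measurableT_comp.
      - by move=> t _; rewrite lee_fin expR_ge0.
      - by rewrite lee_fin powR_ge0.
    rewrite [RHS]integral_mkcond; apply: eq_integral => t _; rewrite patchE KE /S/= y0/=.
    by case: ifPn => [h|/negbTE h]; case: ifPn => //; rewrite ?inE ?notin_setE/= in_itv/= h.
  by rewrite integral0_eq// => t _; rewrite KE /S/= (negbTE (introN idP y0)).
transitivity ((a + 1)%:E * \int[leb]_y \int[leb]_t K (y, t))%E; last first.
  by congr (_ * _)%E; exact: E1.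
transitivity (\int[leb]_t ((a + 1)%:E * \int[leb]_y K (y, t)))%E; last first.
  rewrite ge0_integralZl.
  - by congr (_ * _)%E; exact/esym/FT.
  - exact: measurableT.
  - exact: (measurable_fun_fubini_tonelli_G (m1 := leb) K).
  - by move=> t _; exact: integral_ge0.
  - by rewrite lee_fin ltW.
rewrite integral_mkcond; apply: eq_integral => t _; rewrite patchE.
case: ifPn => [|]; rewrite ?inE ?notin_setE/= in_itv/= andbT => t0; last first.
  rewrite integral0_eq ?mule0// => y _; rewrite KE /S/=; case: ifP => // /andP[_ h].
  by exfalso; apply: t0; rewrite (le_trans _ h)// powR_ge0.
have E y : K (y, t) = ((((fun y => (y `^ a)%:E) \_ `[0%R, (t `^ p^-1)%R]) y) * (expR (- t))%:E)%E.
  rewrite KE /S/= patchE.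
  have -> : (y \in `[0%R, (t `^ p^-1)%R]%classic) = (0 <= y) && (y `^ p <= t).
    apply/idP/idP; rewrite inE/= in_itv/= => /andP[y0 h]; rewrite y0/=.
      have := ge0_ler_powR (ltW p0) _ _ h; rewrite -powRrM mulVf ?gt_eqF// powRr1//.
      by apply; rewrite nnegrE// powR_ge0.
    have := ge0_ler_powR (_ : 0 <= p^-1) _ _ h.
    rewrite -powRrM mulfV ?gt_eqF// powRr1//.
    by apply; rewrite ?nnegrE ?powR_ge0// invr_ge0 ltW.
  by case: ifP => _; rewrite ?mul0e// EFinM.
under eq_integral do rewrite E.
rewrite ge0_integralZr; last 4 first.
- exact: measurableT.
- apply/(measurable_restrictT _ _).1; first exact: measurable_itv.
  by apply/measurable_EFinP; apply: measurable_funTS; exact: measurable_powR.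
- by move=> y _; apply: erestrict_ge0 => z _; rewrite lee_fin powR_ge0.
- by rewrite lee_fin expR_ge0.
rewrite -integral_mkcond integral_powR ?powR_ge0// -!EFinM -powRrM.
by congr EFin; rewrite (mulrC p^-1); field; rewrite gt_eqF.
Qed.

End one_dim.

(** * Absolute moments of the p-Gaussian density *)

Section gint.
Context {R : realType}.
Local Notation leb := (@lebesgue_measure R).

(* [gdens p 0 1] is the unnormalized p-Gaussian density, so
   [gint p a 1 / gint p 0 1] is its [a]-th absolute moment. *)
Definition gdens (p a d y : R) : R := `|y| `^ a * expR (- (d * `|y| `^ p / p)).

(** The parameter [d] is the fraction of the Gaussian exponent left after a tilt. Taking [fine]
    loses nothing for p >= 1, a >= 0, d > 0, by [gintE]. *)
Definition gint (p a d : R) : R := fine (\int[leb]_y (gdens p a d y)%:E)%E.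

Lemma gdens_ge0 p a d y : 0 <= gdens p a d y.
Proof. by rewrite mulr_ge0 ?powR_ge0// expR_ge0. Qed.

Lemma measurable_abs_powR (a : R) : measurable_fun setT (fun y : R => `|y| `^ a).
Proof.
apply: (measurableT_comp (measurable_powR a)); exact: normr_measurable.
Qed.

Lemma measurable_gdens p a d : measurable_fun setT (gdens p a d).
Proof.
apply: measurable_funM; first exact: measurable_abs_powR.
apply: measurableT_comp => //; apply: measurableT_comp => //.
apply: measurable_funM => //; apply: measurable_funM => //.
exact: measurable_abs_powR.
Qed.

(** Allows the density to be dominated by an exponential of |y|; the loss of 1 covers y < 1, where
    y^p can drop below y. *)
Lemma powR_ge_subr1 (p y : R) : 1 <= p -> 0 <= y -> y - 1 <= y `^ p.
Proof.
move=> p1 y0; have [y1|y1] := leP 1 y.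
  by apply: (@le_trans _ _ y); [rewrite gerBl|exact: le1r_powR].
by apply: (@le_trans _ _ 0); [rewrite subr_le0 ltW|exact: powR_ge0].
Qed.

Lemma powR_le_expR (a k : R) : 0 <= a -> 0 < k ->
  exists2 C : R, 0 < C & forall y, 0 <= y -> y `^ a <= C * expR (k * y).
Proof.
move=> a0 k0; have a1 : 0 < a + 1 by rewrite ltr_wpDl.
(* From ln (s y) <= s y one gets a ln y <= a s y - a ln s, and a s <= k. Dividing by a + 1 keeps [s]
   defined at a = 0; the summand 1 in the constant takes care of y = 0. *)
pose s := k / (a + 1); have s0 : 0 < s by rewrite divr_gt0.
exists (1 + expR (- (a * ln s))); first by rewrite addr_gt0// expR_gt0.
move=> y; rewrite le_eqVlt => /predU1P[<-|y0].
  rewrite mulr0 expR0 mulr1 (@le_trans _ _ 1)// ?lerDl ?expR_ge0//.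
  have [->|a_neq0] := eqVneq a 0; first by rewrite powRr0.
  by rewrite powR0.
rewrite mulrDl mul1r; apply: ler_wpDl; first exact: expR_ge0.
rewrite -expRD /powR gt_eqF// ler_expR.
have h : ln s + ln y <= s * y.
  by rewrite -lnM ?posrE//; apply: ltW; apply: ln_sublinear; exact: mulr_gt0.
have h2 : a * s <= k.
  by rewrite /s mulrCA ger_pMr// ler_pdivrMr// mul1r lerDl.
rewrite addrC -lerBlDr opprK -mulrDr addrC (le_trans (ler_wpM2l a0 h))//.
by rewrite mulrA ler_wpM2r// ltW.
Qed.

Lemma integral_expR_abs (k : R) : 0 < k ->
  (\int[leb]_y (expR (- (k * `|y|)))%:E < +oo)%E.
Proof.
move=> k0.
have mE : measurable_fun setT (fun y : R => (expR (- `|y|))%:E).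
  apply/measurable_EFinP; apply: measurableT_comp => //.
  by apply: measurableT_comp.
have -> : (\int[leb]_y (expR (- (k * `|y|)))%:E =
    \int[leb]_y (expR (- `|(k * y)%R|))%:E)%E.
  by apply: eq_integral => y _; rewrite normrM gtr0_norm.
rewrite (ge0_integral_scale (h := fun y : R => (expR (- `|y|))%:E) k0 mE); last first.
  by move=> x; rewrite lee_fin expR_ge0.
rewrite (ge0_integral_even mE); last 2 first.
- by move=> x; rewrite lee_fin expR_ge0.
- by move=> x; rewrite normrN.
have -> : (\int[leb]_(x in `[0%R, +oo[) (expR (- `|x|))%:E =
    \int[leb]_(x in `[0%R, +oo[) (expR (- x))%:E)%E.
  by apply: eq_integral => y; rewrite inE/= in_itv/= andbT => y0; rewrite ger0_norm.
by rewrite integral_expRN -!EFinM ltry.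
Qed.

Lemma gintE (p a d : R) : 1 <= p -> 0 <= a -> 0 < d ->
  (\int[leb]_y (gdens p a d y)%:E = (gint p a d)%:E)%E.
Proof.
move=> p1 a0 d0; have p0 : 0 < p by rewrite (lt_le_trans _ p1).
rewrite /gint fineK// ge0_fin_numE; last first.
  by apply: integral_ge0 => y _; rewrite lee_fin gdens_ge0.
(* The density decays at rate d / p = 2 k in |y|: one half absorbs the power |y|^a, the other half
   stays integrable. *)
pose k := d / p / 2; have k0 : 0 < k by rewrite !divr_gt0.
have [C C0 HC] := powR_le_expR a0 k0.
apply: (@le_lt_trans _ _
  (\int[leb]_y ((C * expR (d / p))%:E * (expR (- (k * `|y|)))%:E))%E).
  apply: ge0_le_integral.
  - exact: measurableT.
  - by move=> y _; rewrite lee_fin gdens_ge0.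
  - by apply/measurable_EFinP; exact: measurable_gdens.
  - apply: measurable_funeM; apply/measurable_EFinP; apply: measurableT_comp => //.
    apply: measurableT_comp => //; exact: measurable_funM.
  - move=> y _; rewrite -EFinM lee_fin /gdens.
    apply: (@le_trans _ _ (C * expR (k * `|y|) * expR (- (d / p * (`|y| - 1))))).
      apply: ler_pM; rewrite ?powR_ge0 ?expR_ge0 ?HC//.
      rewrite ler_expR lerN2 [leRHS]mulrAC ler_wpM2l ?divr_ge0 ?(ltW d0) ?(ltW p0)//.
      exact: powR_ge_subr1.
    have -> : d / p = k * 2 by rewrite /k divfK.
    rewrite -!mulrA ler_pM2l// -!expRD ler_expR.
    lra.
rewrite ge0_integralZl.
- by rewrite lte_mul_pinfty ?lee_fin ?mulr_ge0 ?expR_ge0 ?(ltW C0)// integral_expR_abs.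
- exact: measurableT.
- apply/measurable_EFinP; apply: measurableT_comp => //.
  apply: measurableT_comp => //; exact: measurable_funM.
- by move=> y _; rewrite lee_fin expR_ge0.
- by rewrite lee_fin mulr_ge0 ?expR_ge0 ?(ltW C0).
Qed.

Lemma gint_gt0 (p a d : R) : 1 <= p -> 0 <= a -> 0 < d -> 0 < gint p a d.
Proof.
move=> p1 a0 d0; have p0 : 0 < p by rewrite (lt_le_trans _ p1).
rewrite -lte_fin -gintE//.
pose e := expR (- (d * 2 `^ p / p)).
apply: (@lt_le_trans _ _ e%:E); first by rewrite lte_fin expR_gt0.
have -> : e%:E = (\int[leb]_(y in `[1%R, 2%R]) (cst e%:E y))%E.
  rewrite integral_cst; last exact: measurable_itv.
  rewrite -[LHS]mule1; congr (_ * _)%E; apply/esym.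
  rewrite [LHS](lebesgue_measure_itv `[1%R : R, 2%R])/= lte_fin ltr1n -EFinD.
  by congr EFin; lra.
apply: (@le_trans _ _ (\int[leb]_(y in `[1%R, 2%R]) (gdens p a d y)%:E)%E).
  apply: ge0_le_integral.
  - exact: measurable_itv.
  - by move=> y _; rewrite lee_fin expR_ge0.
  - exact: measurable_cst.
  - by apply/measurable_EFinP; apply: measurable_funTS; exact: measurable_gdens.
  - move=> y; rewrite /= in_itv/= => /andP[y1 y2].
    have y0 : 0 <= y by rewrite (le_trans _ y1).
    rewrite lee_fin /gdens ger0_norm// -[leLHS]mul1r ler_pM ?expR_ge0//.
      by rewrite -(powRr0 y); exact: ler_powR.
    rewrite ler_expR lerN2 ler_pM2r ?invr_gt0// ler_pM2l//.
    by apply: ge0_ler_powR; rewrite ?nnegrE// ltW.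
apply: ge0_subset_integral => //.
- by apply/measurable_EFinP; exact: measurable_gdens.
- by move=> y _; rewrite lee_fin gdens_ge0.
Qed.

Lemma Gamma_gint (p a : R) : 1 <= p -> 0 <= a ->
  Gamma (1 + (a + 1) / p) = (a + 1) * p `^ (- ((a + 1) / p)) * gint p a 1 / 2.
Proof.
move=> p1 a0; have p0 : 0 < p by rewrite (lt_le_trans _ p1).
have mH : measurable_fun setT (fun y : R => (`|y| `^ a * expR (- `|y| `^ p))%:E).
  apply/measurable_EFinP; apply: measurable_funM; first exact: measurable_abs_powR.
  by apply: measurableT_comp => //; apply: measurableT_comp => //; exact: measurable_abs_powR.
have H0 (y : R) : (0 <= (`|y| `^ a * expR (- `|y| `^ p))%:E)%E.
  by rewrite lee_fin mulr_ge0 ?powR_ge0// expR_ge0.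
rewrite /Gamma addrAC subrr add0r integral_Gamma_powR//.
(* The change of scale by p^(1/p) turns exp(- y^p / p) into exp(- y^p). *)
pose r := p `^ p^-1; have r0 : 0 < r by rewrite powR_gt0.
have := ge0_integral_scale (h := fun y => (gdens p a 1 y)%:E) r0.
rewrite gintE//.
have -> : (\int[leb]_x (gdens p a 1 (r * x))%:E =
   (r `^ a)%:E * \int[leb]_y (`|y| `^ a * expR (- `|y| `^ p))%:E)%E.
  rewrite -ge0_integralZl//; last by rewrite lee_fin powR_ge0.
  apply: eq_integral => y _; rewrite -EFinM /gdens normrM (gtr0_norm r0).
  rewrite powRM ?(ltW r0)// mulrA powRM ?(ltW r0)//.
  have -> : r `^ p = p by rewrite /r -powRrM mulVf ?gt_eqF// powRr1// ltW.
  by rewrite mul1r (mulrC p) mulfK// gt_eqF.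
rewrite (ge0_integral_even mH H0); last by move=> y; rewrite normrN.
have -> : (\int[leb]_(y in `[0%R, +oo[) (`|y| `^ a * expR (- `|y| `^ p))%:E =
   \int[leb]_(y in `[0%R, +oo[) (y `^ a * expR (- y `^ p))%:E)%E.
  by apply: eq_integral => y; rewrite inE/= in_itv/= andbT => y0; rewrite ger0_norm.
set h := (\int[leb]_(_ in _) _)%E.
have h0 : (0 <= h)%E.
  by apply: integral_ge0 => y _; rewrite lee_fin mulr_ge0 ?powR_ge0// expR_ge0.
have m2 : measurable_fun [set: R] (fun y : R => (gdens p a 1 y)%:E).
  by apply/measurable_EFinP; exact: measurable_gdens.
move=> /(_ m2 (fun x => gdens_ge0 p a 1 x)).
(* [Gamma] is defined through [fine], which would hide a divergent integral; the scaling identity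
   with a finite right-hand side excludes that case. *)
case: h h0 => [h|_|//] h0.
  rewrite -!EFinM => -[E]; rewrite /=.
  have -> : h = r^-1 * gint p a 1 / r `^ a / 2.
    by rewrite -E; field; rewrite gt_eqF// powR_gt0.
  have -> : p `^ (- ((a + 1) / p)) = (r `^ a * r)^-1.
    rewrite powRN mulrDl mul1r powRD; last by rewrite (gt_eqF p0) implybT.
    by rewrite -/r (mulrC a) powRrM -/r.
  by field; rewrite !gt_eqF// powR_gt0.
have t0 : (0 < 2%:E :> \bar R)%E by rewrite lte_fin.
have ra0 : (0 < (r `^ a)%:E)%E by rewrite lte_fin powR_gt0.
by move: h0; rewrite (gt0_muley t0) (gt0_muley ra0) -EFinM.
Qed.

(** Both Gamma values are p-Gaussian integrals and the powers of p cancel, so [Mp] is the q-th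
    absolute moment of one coordinate. *)
Lemma Mp_gint (p q : R) : 1 <= p -> 0 <= q -> Mp p q = gint p q 1 / gint p 0 1.
Proof.
move=> p1 q0; have p0 : 0 < p by rewrite (lt_le_trans _ p1).
have p1E : 1 + p^-1 = 1 + (0 + 1) / p by rewrite add0r mul1r.
rewrite /Mp p1E (Gamma_gint p1 q0) (Gamma_gint p1 (lexx 0)) add0r !mul1r.
have -> : p `^ (- ((q + 1) / p)) = (p `^ (q / p) * p `^ p^-1)^-1.
  by rewrite powRN mulrDl mul1r powRD// (gt_eqF p0) implybT.
rewrite powRN; field.
by rewrite !gt_eqF// ?powR_gt0 ?gint_gt0// ltr_wpDl.
Qed.

End gint.

(** * Volumes of balls against the p-Gaussian product density *)

Section isint.
Context {R : realType}.
Local Notation leb := (@lebesgue_measure R).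

(** Relational form of a finite integral: the real value travels with the function, so sums and
    products of integrals are computed in [R]. *)
Definition isint (f : R -> R) (c : R) : Prop :=
  [/\ measurable_fun setT f, forall x, 0 <= f x & (\int[leb]_x (f x)%:E = c%:E)%E].

Lemma isint_ge0 f c : isint f c -> 0 <= c.
Proof.
by move=> [_ f0 E]; rewrite -lee_fin -E; apply: integral_ge0 => x _; rewrite lee_fin.
Qed.

Lemma isint_gdens (p a d : R) : 1 <= p -> 0 <= a -> 0 < d ->
  isint (gdens p a d) (gint p a d).
Proof.
move=> p1 a0 d0; split; [exact: measurable_gdens|exact: gdens_ge0|exact: gintE].
Qed.

Lemma isintD f g c d : isint f c -> isint g d -> isint (fun x => f x + g x) (c + d).
Proof.
move=> [mf f0 fc] [mg g0 gd]; split.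
- exact: measurable_funD.
- by move=> x; rewrite addr_ge0.
- under eq_integral do rewrite EFinD.
  rewrite ge0_integralD.
  + by rewrite fc gd.
  + exact: measurableT.
  + by move=> x _; rewrite lee_fin.
  + exact/measurable_EFinP.
  + by move=> x _; rewrite lee_fin.
  + exact/measurable_EFinP.
Qed.

Lemma isintZ k f c : 0 <= k -> isint f c -> isint (fun x => k * f x) (k * c).
Proof.
move=> k0 [mf f0 fc]; split.
- exact: measurable_funM.
- by move=> x; rewrite mulr_ge0.
- under eq_integral do rewrite EFinM.
  rewrite ge0_integralZl.
  + by rewrite fc.
  + exact: measurableT.
  + exact/measurable_EFinP.
  + by move=> x _; rewrite lee_fin.
  + by rewrite lee_fin.
Qed.

(** Provides a value for integrals without a closed form, namely those of the tilted densities in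
    the Chernoff bounds. *)
Lemma isint_le (f g : R -> R) (d : R) : measurable_fun setT f -> (forall x, 0 <= f x) ->
  (forall x, f x <= g x) -> isint g d -> exists2 c, isint f c & c <= d.
Proof.
move=> mf f0 fg [mg g0 gd].
have le : (\int[leb]_x (f x)%:E <= d%:E)%E.
  rewrite -gd; apply: ge0_le_integral.
  - exact: measurableT.
  - by move=> x _; rewrite lee_fin.
  - exact/measurable_EFinP.
  - exact/measurable_EFinP.
  - by move=> x _; rewrite lee_fin.
have fin : (\int[leb]_x (f x)%:E)%E \is a fin_num.
  rewrite ge0_fin_numE; first by rewrite (le_lt_trans le)// ltry.
  by apply: integral_ge0 => x _; rewrite lee_fin.
exists (fine (\int[leb]_x (f x)%:E)%E); first by split => //; rewrite fineK.
by rewrite -lee_fin fineK.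
Qed.

End isint.

Section balls.
Context {R : realType} (p : R).
Hypothesis p1 : 1 <= p.
Let p0 : 0 < p. Proof. exact: lt_le_trans p1. Qed.

Definition powsum (a : R) n (y : n.-tuple R) : R := \sum_(i < n) `|tnth y i| `^ a.

(** The parameter bounds the power sum and not the norm, so the radius is t^(1/p); fixing a
    coordinate x then just replaces t by t - |x|^p. *)
Definition pball n (t : R) : set (n.-tuple R) := [set y | powsum p y <= t].

(* Only meant for sets of finite volume: [fine] sends [+oo] to [0]. *)
Definition rvol n (A : set (n.-tuple R)) : R := fine (vol A).

Lemma powsum_ge0 a n (y : n.-tuple R) : 0 <= powsum a y.
Proof. by apply: sumr_ge0 => i _; exact: powR_ge0. Qed.

Lemma measurable_powsum a n : measurable_fun setT (@powsum a n).
Proof.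
apply: measurable_sum => i.
by apply: (measurableT_comp (measurable_abs_powR a)); exact: measurable_tnth.
Qed.

Lemma powsum_scale (a r : R) n (y : n.-tuple R) : 0 <= r ->
  powsum a (scale_tuple r y) = r `^ a * powsum a y.
Proof.
move=> r0; rewrite /powsum mulr_sumr; apply: eq_bigr => i _.
by rewrite tnth_map normrM powRM// ger0_norm.
Qed.

Lemma powsum_cons (a : R) n (x : R) (y : n.-tuple R) :
  powsum a (cons_tuple x y) = `|x| `^ a + powsum a y.
Proof.
rewrite /powsum big_ord_recl; congr (_ + _).
by apply: eq_bigr => i _; rewrite tnthS.
Qed.

Lemma measurable_powsum_preimage (a : R) n (A : set R) : measurable A ->
  measurable [set y : n.-tuple R | A (powsum a y)].
Proof.
by move=> mA; rewrite -[X in measurable X]setTI; exact: measurable_powsum.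
Qed.

Lemma measurable_pball n t : measurable (@pball n t).
Proof.
rewrite (_ : pball t = [set y : n.-tuple R | `]-oo, t]%classic (powsum p y)]).
  by apply: measurable_powsum_preimage; exact: measurable_itv.
by apply/seteqP; split => y; rewrite /= in_itv.
Qed.

Lemma prod_gdens0 (d : R) n (y : n.-tuple R) (f : nat -> R) :
  (forall i : 'I_n, f i = d) ->
  \prod_(i < n) gdens p 0 (f i) (tnth y i) = expR (- (d * powsum p y / p)).
Proof.
move=> fd; rewrite /powsum mulr_sumr mulr_suml -sumrN expR_sum.
by apply: eq_bigr => i _; rewrite /gdens powRr0 mul1r fd.
Qed.

(** A crude bound whose purpose is finiteness: it makes [rvol] faithful on subsets of balls. *)
Lemma vol_pball_le n (t : R) : (vol (@pball n t) <= (expR (t / p) * gint p 0 1 ^+ n)%:E)%E.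
Proof.
have := @vol_le_prod R n (pball t) (expR (t / p)) (fun=> gdens p 0 1) (fun=> gint p 0 1).
rewrite prodr_const card_ord; apply.
- exact: measurable_pball.
- exact: expR_ge0.
- by move=> _; exact: measurable_gdens.
- by move=> _; exact: gdens_ge0.
- by move=> _; exact: gintE.
- move=> y; rewrite /pball/= => yt.
  rewrite (@prod_gdens0 1 n y (fun=> 1))// -expRD -[leLHS]expR0 ler_expR mul1r -mulrBl.
  by rewrite divr_ge0 ?subr_ge0// ltW.
Qed.

Lemma rvolE n t (A : set (n.-tuple R)) : measurable A -> A `<=` pball t ->
  vol A = (rvol A)%:E.
Proof.
move=> mA At; rewrite fineK// ge0_fin_numE ?vol_ge0//.
apply: (@le_lt_trans _ _ (vol (@pball n t))).
  by rewrite le_measure ?inE//; exact: measurable_pball.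
by rewrite (le_lt_trans (vol_pball_le _ _))// ltry.
Qed.

Lemma rvol_ge0 n (A : set (n.-tuple R)) : 0 <= rvol A.
Proof. by rewrite fine_ge0// vol_ge0. Qed.

Lemma le_rvol n t (A B : set (n.-tuple R)) : measurable A -> measurable B ->
  B `<=` pball t -> A `<=` B -> rvol A <= rvol B.
Proof.
move=> mA mB Bt AB; rewrite -lee_fin -(rvolE mA (subset_trans AB Bt)) -(rvolE mB Bt).
by rewrite le_measure ?inE.
Qed.

Lemma rvolU_le n t (A B : set (n.-tuple R)) : measurable A -> measurable B ->
  A `<=` pball t -> B `<=` pball t -> rvol (A `|` B) <= rvol A + rvol B.
Proof.
move=> mA mB At Bt; have mAB := measurableU _ _ mA mB.
rewrite -lee_fin EFinD -(rvolE mA At) -(rvolE mB Bt) -(@rvolE n t)//; last first.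
  by rewrite subUset.
exact: measureU2.
Qed.

Lemma rvol_le_prod n t (A : set (n.-tuple R)) (C : R) (f : nat -> R -> R) (c : nat -> R) :
  measurable A -> A `<=` pball t -> 0 <= C -> (forall i, isint (f i) (c i)) ->
  (forall y, A y -> 1 <= C * \prod_(i < n) f i (tnth y i)) ->
  rvol A <= C * \prod_(i < n) c i.
Proof.
move=> mA At C0 fc H; rewrite -lee_fin -(rvolE mA At).
by apply: vol_le_prod H => // i; have [] := fc i.
Qed.

Lemma rvol_scale n (r : R) (A : set (n.-tuple R)) : 0 < r -> measurable A ->
  rvol [set y | A (scale_tuple r y)] = r^-1 ^+ n * rvol A.
Proof.
move=> r0 mA; rewrite /rvol vol_scale//.
have k0 : (0 < (r^-1 ^+ n)%:E)%E by rewrite lte_fin exprn_gt0// invr_gt0.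
(* For infinite volume both sides are 0, because [fine] sends [+oo] to 0. *)
have := vol_ge0 A; case: (vol A) => [v|_|//]; first by [].
by rewrite gt0_muley// mulr0.
Qed.

Lemma rvol_pball n (t : R) : 0 < t ->
  rvol (@pball n t) = t `^ (n%:R / p) * rvol (@pball n 1).
Proof.
move=> t0; pose r := (t `^ p^-1)^-1.
have r0 : 0 < r by rewrite invr_gt0 powR_gt0.
have rp : r `^ p = t^-1.
  by rewrite /r -powRN -powRrM mulNr mulVf ?gt_eqF// powRN powRr1 ?ltW.
have -> : @pball n t = [set y | pball 1 (scale_tuple r y)].
  apply/seteqP; split => y; rewrite /pball/= powsum_scale ?(ltW r0)// rp;
    by rewrite ler_pdivrMl// mulr1.
rewrite rvol_scale//; last exact: measurable_pball.
by rewrite invrK -powR_mulrn ?powR_ge0// -powRrM (mulrC p^-1).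
Qed.

(* [t ^ (n / p + 2) * expR (- t / p)] is maximal at [t = n + 2 * p]; the extra
   factor [t ^ 2] makes the sum over the layers of [expR_layer_le] converge. *)
Lemma pball_term_le (n j : nat) : (0 < n)%N -> (0 < j)%N ->
  expR (- (j%:R / p)) * j%:R `^ (n%:R / p) <=
  (j%:R ^+ 2)^-1 * ((n%:R + 2 * p) ^+ 2 * (n%:R `^ (n%:R / p) * expR (- (n%:R / p)))).
Proof.
move=> n0 j0; have n0' : (0 : R) < n%:R by rewrite ltr0n.
have j0' : (0 : R) < j%:R by rewrite ltr0n.
set N := n%:R : R; set J := j%:R : R; set m := N + 2 * p.
have m0 : 0 < m by rewrite addr_gt0// mulr_gt0.
have sq (x : R) : 0 < x -> x ^+ 2 = expR (2 * ln x).
  by move=> x0; rewrite expRM_natl lnK.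
have pw (x : R) a : 0 < x -> x `^ a = expR (a * ln x) by move=> x0; rewrite /powR gt_eqF.
rewrite !sq// !pw// -expRN -!expRD ler_expR.
have lnle (x y : R) : 0 < x -> 0 < y -> ln x <= ln y + (x / y - 1).
  move=> x0 y0; rewrite -lerBlDl -ln_div ?posrE//.
  have := @le_ln1Dx R (x / y - 1); rewrite [1 + _]addrC subrK; apply.
  by rewrite ltrBrDl subrr divr_gt0.
(* Two tangent bounds for ln: the one at [m] bounds ln J, the one at [N] bounds ln m. The second
   converts (N / p) ln m into (N / p) ln N + 2, and that 2 cancels against m / p = N / p + 2. *)
have h1 := ler_wpM2l (divr_ge0 (ltW m0) (ltW p0)) (lnle J m j0' m0).
have h2 := ler_wpM2l (divr_ge0 (ltW n0') (ltW p0)) (lnle m N m0 n0').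
have e1 : m / p * (ln m + (J / m - 1)) = m / p * ln m + J / p - m / p.
  by field; rewrite !gt_eqF.
have e2 : N / p * (ln N + (m / N - 1)) = N / p * ln N + 2.
  by rewrite /m; field; rewrite !gt_eqF.
have e3 : m / p = N / p + 2 by rewrite /m; field; rewrite gt_eqF.
rewrite e1 e3 in h1; rewrite e2 in h2.
lra.
Qed.

(** The single term k = [Num.truncn s] suffices. The indicator is that of the whole ball
    [s <= k + 1] rather than of a layer, so that integrating the sum produces ball volumes. *)
Lemma expR_layer_le (s : R) : 0 <= s ->
  ((expR (- (s / p)))%:E <=
   \sum_(k <oo) (expR (- (k%:R / p)) * (s <= k.+1%:R)%R%:R)%:E)%E.
Proof.
move=> s0; pose k := Num.truncn s.
have /andP[ks sk] := truncn_itv s0.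
apply: (@le_trans _ _ (\sum_(0 <= i < k.+1) (expR (- (i%:R / p)) * (s <= i.+1%:R)%R%:R)%:E)%E).
  rewrite big_nat_recr//= -[leLHS]add0e; apply: leeD.
    by apply: sume_ge0 => i _; rewrite lee_fin mulr_ge0 ?expR_ge0.
  rewrite lee_fin (ltW sk) mulr1 ler_expR lerN2 ler_pM2r ?invr_gt0//.
by apply: nneseries_lim_ge => i _ _; rewrite lee_fin mulr_ge0 ?expR_ge0.
Qed.

(** The correction 2 / (N + 1) makes the induction telescope: 1 / x^2 <= 2 / x - 2 / (x + 1) for x
    >= 1. *)
Lemma sum_inv_sqr_le (N : nat) : \sum_(0 <= k < N) ((k.+1%:R : R) ^+ 2)^-1 <= 2 - 2 / N.+1%:R.
Proof.
elim: N => [|N IH]; first by rewrite big_nil divr1 subrr.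
rewrite big_nat_recr//=.
have N0 : 0 < (N.+1%:R : R) by rewrite ltr0n.
have N1 : (N.+2%:R : R) = N.+1%:R + 1 by rewrite -natr1.
suff h : ((N.+1%:R : R) ^+ 2)^-1 <= 2 / N.+1%:R - 2 / N.+2%:R.
  by rewrite (le_trans (lerD IH h))// addrA subrK.
rewrite N1; set x := N.+1%:R in N0 *.
have x1 : 1 <= x by rewrite /x -natr1 lerDr.
have -> : 2 / x - 2 / (x + 1) = 2 / (x * (x + 1)).
  by field; rewrite !gt_eqF// addr_gt0.
rewrite -[leLHS]mul1r ler_pdivrMr ?exprn_gt0// mulrAC ler_pdivlMr; last first.
  by rewrite mulr_gt0// addr_gt0.
nra.
Qed.

(** The 2 bounds the sum of inverse squares, exp(1 / p) pays for the index shift from k to k + 1,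
    and the square comes from [pball_term_le]. *)
Definition poly_factor (n : nat) : R := 2 * expR p^-1 * (n%:R + 2 * p) ^+ 2.

(* Integrating [expR (- powsum p y / p)] over the layers [k <= powsum p y < k + 1]
   gives a sharp enough lower bound for the volume without Stirling's formula. *)
Lemma gint_expn_le n : (0 < n)%N ->
  gint p 0 1 ^+ n * expR (n%:R / p) <= poly_factor n * rvol (@pball n n%:R).
Proof.
move=> n0; have n0' : (0 : R) < n%:R by rewrite ltr0n.
rewrite rvol_pball//.
set v := rvol (pball 1); have v0 : 0 <= v by exact: rvol_ge0.
pose B := expR p^-1 * ((n%:R + 2 * p) ^+ 2 * (n%:R `^ (n%:R / p) * expR (- (n%:R / p)))) * v.
have B0 : 0 <= B.
  by rewrite !mulr_ge0 ?expR_ge0 ?exprn_ge0 ?powR_ge0// addr_ge0 ?mulr_ge0// ?ltW.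
suff H : gint p 0 1 ^+ n <= 2 * B.
  rewrite -ler_pdivlMr ?expR_gt0//; apply: (le_trans H).
  rewrite -expRN /B /poly_factor le_eqVlt; apply/orP; left; apply/eqP; ring.
rewrite -lee_fin.
have -> : (gint p 0 1 ^+ n)%:E = (\int[@vol R n]_y (expR (- (powsum p y / p)))%:E)%E.
  have := @integral_vol_prod R n (fun=> gdens p 0 1) (fun=> gint p 0 1).
  rewrite prodr_const card_ord => <-//.
  - apply: eq_integral => y _; congr EFin.
    by rewrite (@prod_gdens0 1 n y (fun=> 1))// mul1r.
  - by move=> _; exact: measurable_gdens.
  - by move=> _; exact: gdens_ge0.
  - by move=> _; exact: gintE.
pose F k (y : n.-tuple R) := (expR (- (k%:R / p)) * \1_(pball k.+1%:R) y)%:E.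
have mF k : measurable_fun setT (F k).
  apply/measurable_EFinP; apply: measurable_funM => //.
  by apply: measurable_indic; exact: measurable_pball.
have F0 k y : (0 <= F k y)%E by rewrite lee_fin mulr_ge0 ?expR_ge0.
apply: (@le_trans _ _ (\int[@vol R n]_y \sum_(k <oo) F k y)%E).
  apply: ge0_le_integral.
  - exact: measurableT.
  - by move=> y _; rewrite lee_fin expR_ge0.
  - apply/measurable_EFinP; apply: measurableT_comp => //.
    by apply: measurableT_comp => //; apply: measurable_funM => //; exact: measurable_powsum.
  - by apply: ge0_emeasurable_sum.
  - move=> y _; apply: (le_trans (expR_layer_le (powsum_ge0 p y))).
    rewrite le_eqVlt; apply/orP; left; apply/eqP.
    apply: eq_eseriesr => k _; rewrite /F indicE; congr (_ * _%:R)%:E.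
    by congr nat_of_bool; apply/idP/idP; rewrite inE.
rewrite integral_nneseries//.
apply: lime_le.
  by apply: is_cvg_nneseries => k _ _; apply: integral_ge0.
apply: nearW => N.
apply: (@le_trans _ _ (\sum_(0 <= k < N) (((k.+1%:R : R) ^+ 2)^-1 * B)%:E)%E).
  apply: lee_sum => k _.
  have -> : (\int[@vol R n]_y F k y = (expR (- (k%:R / p)) * rvol (@pball n k.+1%:R))%:E)%E.
    rewrite /F; under eq_integral do rewrite EFinM.
    rewrite ge0_integralZl; last 4 first.
    - exact: measurableT.
    - by apply/measurable_EFinP; apply: measurable_indic; exact: measurable_pball.
    - by move=> y _; rewrite lee_fin.
    - by rewrite lee_fin expR_ge0.
    rewrite integral_indic; last 2 first.
    - exact: measurableT.
    - exact: measurable_pball.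
    rewrite setIT EFinM; congr (_ * _)%E.
    by apply: (@rvolE n k.+1%:R) => //; exact: measurable_pball.
  rewrite lee_fin rvol_pball ?ltr0n// mulrA [leRHS]mulrA; apply: ler_wpM2r => //.
  have h := ler_wpM2l (expR_ge0 p^-1) (pball_term_le n0 (ltn0Sn k)).
  rewrite [leLHS]mulrA -expRD [leRHS]mulrCA in h.
  suff -> : - (k%:R / p) = p^-1 - k.+1%:R / p by [].
  by rewrite -natr1; field; rewrite gt_eqF.
rewrite sumEFin lee_fin -mulr_suml ler_wpM2r//.
by rewrite (le_trans (sum_inv_sqr_le N))// gerBl divr_ge0.
Qed.

End balls.

(** * Exponential bounds at fixed dimension *)

Section tails.
Context {R : realType} (p q : R).
Hypotheses (p1 : 1 <= p) (pq : p < q).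
Let p0 : 0 < p. Proof. exact: lt_le_trans p1. Qed.
Let q0 : 0 < q. Proof. exact: lt_trans pq. Qed.
Local Notation c0 := (gint p 0 1).
Local Notation m := (gint p q 1 / gint p 0 1).
Let c0_gt0 : 0 < c0. Proof. exact: gint_gt0. Qed.

Lemma isint_mono (f g : R -> R) c d : (forall x, f x <= g x) ->
  isint f c -> isint g d -> c <= d.
Proof.
move=> fg [mf f0 fc] ig; have [c' [_ _ fc'] c'd] := isint_le mf f0 fg ig.
by have [->] : c%:E = c'%:E by rewrite -fc -fc'.
Qed.

Definition prob n (F : set (n.-tuple R)) : R :=
  rvol (@pball R p n n%:R `&` F) / rvol (@pball R p n n%:R).

Lemma poly_factor_gt0 n : 0 < poly_factor p n.
Proof.
by rewrite /poly_factor mulr_gt0 ?exprn_gt0 ?mulr_gt0 ?expR_gt0// ltr_wpDl// mulr_gt0.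
Qed.

Lemma rvol_pball_gt0 n : (0 < n)%N -> 0 < rvol (@pball R p n n%:R).
Proof.
move=> n0; rewrite -(pmulr_rgt0 _ (poly_factor_gt0 n)).
by apply: lt_le_trans (gint_expn_le p1 n0); rewrite mulr_gt0 ?exprn_gt0 ?expR_gt0.
Qed.

Lemma prob_ge0 n (F : set (n.-tuple R)) : 0 <= prob F.
Proof. by rewrite /prob divr_ge0 ?rvol_ge0. Qed.

Lemma le_prob n (F G : set (n.-tuple R)) : measurable F -> measurable G ->
  F `<=` G -> prob F <= prob G.
Proof.
move=> mF mG FG; rewrite /prob ler_wpM2r ?invr_ge0 ?rvol_ge0//.
have mD := @measurable_pball R p n n%:R.
by apply: (le_rvol p1 (t := n%:R)); [exact: measurableI|exact: measurableI|exact: subIsetl|exact: setIS].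
Qed.

Lemma probU_le n (F G : set (n.-tuple R)) : measurable F -> measurable G ->
  prob (F `|` G) <= prob F + prob G.
Proof.
move=> mF mG; rewrite /prob -mulrDl ler_wpM2r ?invr_ge0 ?rvol_ge0// setIUr.
have mD := @measurable_pball R p n n%:R.
by apply: (rvolU_le p1 (t := n%:R)); [exact: measurableI|exact: measurableI|exact: subIsetl|exact: subIsetl].
Qed.

Lemma prob_bigU_le n (I : Type) (s : seq I) (F : I -> set (n.-tuple R)) (b : I -> R) :
  (forall i, measurable (F i)) -> (forall i, prob (F i) <= b i) ->
  prob (\big[setU/set0]_(i <- s) F i) <= \sum_(i <- s) b i.
Proof.
move=> mF Fb; elim: s => [|i s IH].
  by rewrite !big_nil /prob setI0 /rvol measure0 mul0r.
rewrite !big_cons (le_trans (probU_le _ _))//; last exact: lerD.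
by apply: bigsetU_measurable => j _; exact: mF.
Qed.

(* The density [expR (- powsum p y / p)] is at least [expR (- n / p)] on the ball, hence
   the uniform law is at most [poly_factor p n] times the p-Gaussian product law. *)
Lemma prob_le_prod n (F : set (n.-tuple R)) (C : R) (f : nat -> R -> R) (c : nat -> R) :
  (0 < n)%N -> measurable F -> 0 <= C -> (forall i, isint (f i) (c i)) ->
  (forall y, powsum p y <= n%:R -> F y -> 1 <= C * \prod_(i < n) f i (tnth y i)) ->
  prob F <= poly_factor p n * (C * \prod_(i < n) c i / (c0 ^+ n * expR (n%:R / p))).
Proof.
move=> n0 mF C0 fc H; have mD := @measurable_pball R p n n%:R.
have h1 : rvol (@pball R p n n%:R `&` F) <= C * \prod_(i < n) c i.
  apply: (rvol_le_prod p1 (t := n%:R) (f := f)) => //; first exact: measurableI.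
  by move=> y [/=]; exact: H.
rewrite /prob ler_pdivrMr ?rvol_pball_gt0//; apply: (le_trans h1).
have cp : 0 <= C * \prod_(i < n) c i.
  by rewrite mulr_ge0// prodr_ge0// => i _; exact: isint_ge0.
have e0 : 0 < c0 ^+ n * expR (n%:R / p) by rewrite mulr_gt0 ?exprn_gt0 ?expR_gt0.
set X := C * _; set Y := c0 ^+ n * _; set V := rvol _.
have -> : poly_factor p n * (X / Y) * V = X * (poly_factor p n * V / Y) by ring.
by rewrite ler_peMr// ler_pdivlMr// mul1r gint_expn_le.
Qed.

(** Via exp(- u) <= 1 / (1 + u) <= 1 - u + u^2. The linear term stands on the left because [isint]
    handles nonnegative functions only. *)
Lemma expRN_le_quad (u : R) : 0 <= u -> expR (- u) + u <= 1 + u ^+ 2.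
Proof.
move=> u0; have u1 : 0 < 1 + u by rewrite ltr_pwDl.
have : expR (- u) <= (1 + u)^-1.
  by rewrite expRN lef_pV2 ?posrE ?expR_gt0// expR_ge1Dx.
have : (1 + u)^-1 <= 1 - u + u ^+ 2.
  rewrite -[leLHS]mul1r ler_pdivrMr//.
  have : 0 <= u ^+ 3 by rewrite exprn_ge0.
  rewrite (_ : (1 - u + u ^+ 2) * (1 + u) = 1 + u ^+ 3); last by ring.
  lra.
lra.
Qed.

(** The remainder keeps the factor exp(u) since u is unbounded; later the density absorbs it. For u
    < 1, multiply exp(u) (1 - u) <= 1 by 1 + u. *)
Lemma expR_le_quad (u : R) : 0 <= u -> expR u <= 1 + u + u ^+ 2 * expR u.
Proof.
move=> u0; have [u1|u1] := leP 1 u.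
  apply: ler_wpDl; first by rewrite addr_ge0.
  by rewrite ler_peMl ?expR_ge0// exprn_ege1.
have h : expR u * (1 - u) <= 1.
  rewrite -[leRHS](expRxMexpNx_1 u) ler_wpM2l ?expR_ge0//.
  exact: expR_ge1Dx.
have : expR u * (1 - u) * (1 + u) <= 1 * (1 + u) by rewrite ler_wpM2r// addr_ge0.
rewrite mul1r (_ : _ * _ * _ = expR u - u ^+ 2 * expR u); last by ring.
lra.
Qed.

Lemma powR_double (v : R) : v `^ (2 * q) = (v `^ q) ^+ 2.
Proof. by rewrite mulrC powRrM -powR_mulrn// powR_ge0. Qed.

(** The tilt exp(- l |y|^q) is bounded, so the second-order expansion holds for every l >= 0 and the
    ordinary Chernoff argument gives a cost linear in n. *)
Lemma lower_tail (e : R) : 0 < e -> exists2 k : R, 0 < k &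
  forall n, (0 < n)%N ->
  @prob n [set y | powsum q y <= n%:R * (m - e)] <= poly_factor p n * expR (- (k * n%:R)).
Proof.
move=> e0; pose G2 := gint p (2 * q) 1.
have G2_gt0 : 0 < G2 by rewrite gint_gt0// mulr_ge0// ltW.
pose m2 := G2 / c0; have m2_gt0 : 0 < m2 by rewrite divr_gt0.
(* Minimizer of l^2 m2 - l e; the minimum - e^2 / (4 m2) gives the rate chosen below. *)
pose l := e / (2 * m2); have l0 : 0 < l by rewrite divr_gt0// mulr_gt0.
pose f y := gdens p 0 1 y * expR (- (l * `|y| `^ q)).
have f0 y : 0 <= f y by rewrite mulr_ge0 ?gdens_ge0 ?expR_ge0.
have mf : measurable_fun setT f.
  apply: measurable_funM; first exact: measurable_gdens.
  apply: measurableT_comp => //; apply: measurableT_comp => //.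
  by apply: measurable_funM => //; exact: measurable_abs_powR.
have i0 := isint_gdens p1 (lexx 0) ltr01.
have i1 := isint_gdens p1 (ltW q0) ltr01.
have i2 : isint (gdens p (2 * q) 1) G2.
  by apply: isint_gdens => //; rewrite mulr_ge0// ltW.
have f_le y : f y <= gdens p 0 1 y.
  rewrite /f ler_piMr ?gdens_ge0// -[leRHS]expR0 ler_expR oppr_le0.
  by rewrite mulr_ge0 ?powR_ge0// ltW.
have [L iL _] := isint_le mf f0 f_le i0.
have L_le : L + l * gint p q 1 <= c0 + l ^+ 2 * G2.
  apply: isint_mono (isintD iL (isintZ (ltW l0) i1)) (isintD i0 (isintZ (sqr_ge0 l) i2)).
  move=> y; rewrite /f /gdens powRr0 mul1r powR_double.
  set w := expR (- (1 * _ / p)); set v := `|y| `^ q.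
  have v0 : 0 <= v by exact: powR_ge0.
  have := expRN_le_quad (mulr_ge0 (ltW l0) v0).
  move=> /(ler_wpM2l (expR_ge0 _ : 0 <= w)).
  by rewrite exprMn; lra.
exists (e ^+ 2 / (4 * m2)); first by rewrite divr_gt0 ?exprn_gt0// mulr_gt0.
move=> n n0; have n0' : (0 : R) < n%:R by rewrite ltr0n.
have mF : measurable [set y : n.-tuple R | powsum q y <= n%:R * (m - e)].
  exact: (@measurable_pball R q n (n%:R * (m - e))).
apply: (le_trans (prob_le_prod (f := fun=> f) (c := fun=> L)
  (C := expR (n%:R / p + l * (n%:R * (m - e)))) n0 mF (expR_ge0 _) (fun=> iL) _)).
  move=> y /= yp yq.
  have -> : \prod_(i < n) f (tnth y i) = expR (- (powsum p y / p) - l * powsum q y).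
    rewrite /f big_split/= (@prod_gdens0 _ p 1 n y (fun=> 1))// mul1r expRD; congr (_ * _).
    by rewrite -expR_sum sumrN -mulr_sumr.
  rewrite -expRD -[leLHS]expR0 ler_expR.
  have h1 : powsum p y / p <= n%:R / p by rewrite ler_pM2r ?invr_gt0.
  have h2 : l * powsum q y <= l * (n%:R * (m - e)) by rewrite ler_wpM2l// ltW.
  lra.
rewrite ler_wpM2l ?(ltW (poly_factor_gt0 n))// prodr_const card_ord.
have e1 : 0 < c0 ^+ n * expR (n%:R / p) by rewrite mulr_gt0 ?exprn_gt0 ?expR_gt0.
rewrite ler_pdivrMr// expRD.
have Lc : L <= c0 * expR (l ^+ 2 * m2 - l * m).
  apply: (@le_trans _ _ (c0 * (1 + (l ^+ 2 * m2 - l * m)))); last first.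
    by rewrite ler_pM2l// expR_ge1Dx.
  have -> : c0 * (1 + (l ^+ 2 * m2 - l * m)) = c0 + l ^+ 2 * G2 - l * gint p q 1.
    by rewrite /m2; field; rewrite gt_eqF.
  by rewrite lerBrDr.
have L0 : 0 <= L by exact: isint_ge0 iL.
have := lerXn2r n L0 (mulr_ge0 (ltW c0_gt0) (expR_ge0 _)) Lc.
rewrite exprMn -expRM_natr => hL.
apply: (le_trans (ler_wpM2l _ hL)); first by rewrite mulr_ge0 ?expR_ge0.
rewrite [leLHS](_ : _ = c0 ^+ n * expR (n%:R / p) *
   (expR (l * (n%:R * (m - e))) * expR ((l ^+ 2 * m2 - l * m) * n%:R))); last by ring.
rewrite [leRHS]mulrC ler_pM2l// -expRD ler_expR.
have lm (z : R) : 0 < z -> e / (2 * z) * z = e / 2 by move=> z0; field; rewrite gt_eqF.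
have le (z : R) : 0 < z -> e ^+ 2 / (4 * z) = e / (2 * z) * (e / 2).
  by move=> z0; field; rewrite gt_eqF.
rewrite (le _ m2_gt0) -/l expr2 -mulrA (lm _ m2_gt0).
move: (m) (n%:R : R) l {l0 L_le f f0 mf f_le iL Lc hL lm le} => M N l.
lra.
Qed.

Local Notation al := (p / q).
Let al_gt0 : 0 < al. Proof. exact: divr_gt0. Qed.
Let al_lt1 : al < 1. Proof. by rewrite ltr_pdivrMr// mul1r. Qed.

Lemma powR_al (v : R) : (v `^ q) `^ al = v `^ p.
Proof. by rewrite -powRrM mulrCA divff ?mulr1// gt_eqF. Qed.

(* The concavity of [v ^ al] turns the linear exponent into at most
   [(1 - d) / p * v ^ al], which the density [expR (- v ^ al / p)] absorbs. *)
Lemma powR_sublin (x v : R) : 0 < x -> 0 <= v -> v <= x -> x `^ (al - 1) * v <= v `^ al.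
Proof.
move=> x0; rewrite le_eqVlt => /predU1P[<- _|v0 vx].
  by rewrite mulr0 powR_ge0.
have -> : v `^ al = v `^ (al - 1) * v.
  by rewrite [RHS]mulrC mulr_powRB1// ltW.
rewrite ler_pM2r// -(opprB 1 al) !powRN lef_pV2 ?posrE ?powR_gt0//.
by apply: ge0_ler_powR; rewrite ?nnegrE ?subr_ge0// ltW.
Qed.

(** Markov's inequality with the weight exp((1 - d) |y_i|^p / p) on coordinate [i] alone. At d = 0
    the tilted density would be constant in y_i, hence not integrable. *)
Lemma single_big_coord (d x : R) n (i : 'I_n) : 0 < d -> d < 1 -> 0 < x ->
  @prob n [set y | x < `|tnth y i| `^ q] <=
  poly_factor p n * (gint p 0 d / c0 * expR (- ((1 - d) * x `^ al / p))).
Proof.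
move=> d0 d1 x0; have n0 : (0 < n)%N by case: n i => [[]//|].
pose D (j : nat) : R := if j == i :> nat then d else 1.
have D0 j : 0 < D j by rewrite /D; case: ifP.
have mF : measurable [set y : n.-tuple R | x < `|tnth y i| `^ q].
  rewrite (_ : [set _ | _] = (fun y : n.-tuple R => `|tnth y i| `^ q) @^-1` `]x, +oo[); last first.
    by apply/seteqP; split => y; rewrite /= in_itv/= andbT.
  rewrite -[X in measurable X]setTI.
  apply: (measurableT_comp (measurable_abs_powR q) (measurable_tnth i)) => //.
apply: (le_trans (prob_le_prod (f := fun j => gdens p 0 (D j)) (c := fun j => gint p 0 (D j))
  (C := expR (n%:R / p - (1 - d) * x `^ al / p)) n0 mF (expR_ge0 _) _ _)).
- by move=> j; exact: isint_gdens.
- move=> y /= yp yi.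
  have -> : \prod_(j < n) gdens p 0 (D j) (tnth y j) =
      expR (- (powsum p y / p) + (1 - d) * `|tnth y i| `^ p / p).
    transitivity (\prod_(j < n) expR (- (D j * `|tnth y j| `^ p / p))).
      by apply: eq_bigr => j _; rewrite /gdens powRr0 mul1r.
    rewrite -expR_sum sumrN -mulr_suml; congr expR.
    rewrite /powsum (bigD1 i)//= [X in _ = - (X / p) + _](bigD1 i)//= {1}/D eqxx.
    rewrite (eq_bigr (fun j => `|tnth y j| `^ p)); first by ring.
    by move=> j ji; rewrite /D ifF ?mul1r//; apply: negbTE.
  rewrite -expRD -[leLHS]expR0 ler_expR.
  have h1 : powsum p y / p <= n%:R / p by rewrite ler_pM2r ?invr_gt0.
  have h2 : (1 - d) * x `^ al / p <= (1 - d) * `|tnth y i| `^ p / p.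
    rewrite ler_pM2r ?invr_gt0// ler_wpM2l ?subr_ge0 ?(ltW d1)//.
    rewrite -(powR_al `|tnth y i|).
    by apply: ge0_ler_powR; rewrite ?nnegrE ?powR_ge0// ltW.
  lra.
rewrite ler_wpM2l ?(ltW (poly_factor_gt0 n))// (bigD1 i)//= {1}/D eqxx.
rewrite (eq_bigr (fun=> c0)); last first.
  by move=> j ji; rewrite /D ifF//; apply: negbTE.
rewrite prodr_const cardC1 card_ord expRD.
rewrite ler_pdivrMr ?mulr_gt0 ?exprn_gt0 ?expR_gt0// le_eqVlt; apply/orP; left; apply/eqP.
have -> : c0 ^+ n = c0 * c0 ^+ n.-1 by rewrite -exprS prednK.
by field; rewrite !gt_eqF.
Qed.

(* Chernoff bound with slope [th = (1 - d) / p * x ^ (al - 1)]. *)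
Lemma truncated_tail (d b x : R) n : (0 < n)%N -> 0 < d -> d < 1 -> 0 < b ->
  x = n%:R * b ->
  @prob n [set y | n%:R * (m + b) <= powsum q y /\ forall i : 'I_n, `|tnth y i| `^ q <= x] <=
  poly_factor p n * (expR (gint p (2 * q) d / c0 * (n%:R * (x `^ (al - 1)) ^+ 2)) *
              expR (- ((1 - d) * x `^ al / p))).
Proof.
move=> n0 d0 d1 b0 xE; have n0' : (0 : R) < n%:R by rewrite ltr0n.
have x0 : 0 < x by rewrite xE mulr_gt0.
pose s := x `^ (al - 1); have s0 : 0 < s by rewrite powR_gt0.
pose th := (1 - d) * s / p.
have d10 : 0 < 1 - d by rewrite subr_gt0.
have th0 : 0 < th by rewrite divr_gt0// mulr_gt0.
have th_s : th <= s.
  rewrite /th ler_pdivrMr//; apply: (@le_trans _ _ s); last by rewrite ler_peMr// ltW.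
  by rewrite ler_piMl ?(ltW s0)// gerBl ltW.
pose G2 := gint p (2 * q) d.
have G2_gt0 : 0 < G2 by rewrite gint_gt0// mulr_ge0// ltW.
pose f y := if `|y| `^ q <= x then gdens p 0 1 y * expR (th * `|y| `^ q) else 0.
have f0 y : 0 <= f y.
  by rewrite /f; case: ifP => // _; rewrite mulr_ge0 ?gdens_ge0 ?expR_ge0.
have mf : measurable_fun setT f.
  apply: measurable_fun_ifT => //.
    by apply: measurable_fun_ler => //; exact: measurable_abs_powR.
  apply: measurable_funM; first exact: measurable_gdens.
  apply: measurableT_comp => //.
  by apply: measurable_funM => //; exact: measurable_abs_powR.
have ig := isintD (isintD (isint_gdens p1 (lexx 0) ltr01)
    (isintZ (ltW th0) (isint_gdens p1 (ltW q0) ltr01)))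
  (isintZ (sqr_ge0 th) (isint_gdens p1 (mulr_ge0 (ler0n R 2) (ltW q0)) d0)).
have [y|L iL L_le] := isint_le mf f0 _ ig.
  rewrite /f; case: ifPn => [vx|_]; last first.
    by rewrite addr_ge0 ?(mulr_ge0 (sqr_ge0 _))// ?gdens_ge0// addr_ge0 ?gdens_ge0// mulr_ge0 ?gdens_ge0// ltW.
  rewrite /gdens powRr0 !mul1r powR_double.
  set u := `|y| `^ p; set v := `|y| `^ q in vx *.
  have v0 : 0 <= v by exact: powR_ge0.
  have tv0 : 0 <= th * v by rewrite mulr_ge0// ltW.
  (* Below the truncation level the tilt uses at most the fraction 1 - d of the exponent. The
     remainder (th v)^2 exp(th v) is thus integrated against the density of parameter [d], which
     yields the moment [G2]. *)
  have tv : th * v <= (1 - d) * u / p.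
    have := powR_sublin x0 v0 vx; rewrite /v powR_al -/v -/u -/s => h.
    by rewrite /th mulrAC ler_pM2r ?invr_gt0// -mulrA ler_pM2l.
  have h1 := ler_wpM2l (expR_ge0 (- (u / p))) (expR_le_quad tv0).
  apply: (le_trans h1).
  have h2 : expR (- (u / p)) * expR (th * v) <= expR (- (d * u / p)).
    by rewrite -expRD ler_expR; lra.
  have h3 := ler_wpM2l (sqr_ge0 (th * v)) h2.
  rewrite exprMn in h3 *.
  lra.
have mF : measurable [set y : n.-tuple R |
    n%:R * (m + b) <= powsum q y /\ forall i : 'I_n, `|tnth y i| `^ q <= x].
  rewrite (_ : [set _ | _] = [set y : n.-tuple R | `[n%:R * (m + b), +oo[%classic (powsum q y)] `&`
      \bigcap_(i in [set: 'I_n]) (fun y : n.-tuple R => `|tnth y i| `^ q) @^-1` `]-oo, x]); last first.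
    apply/seteqP; split => y /=; rewrite in_itv/= andbT => -[h1 h2]; split => //.
      by move=> i _ /=; rewrite in_itv/=.
    by move=> i; have := h2 i I; rewrite /= in_itv.
  apply: measurableI; first by apply: measurable_powsum_preimage; exact: measurable_itv.
  apply: fin_bigcap_measurable => // i _; rewrite -[X in measurable X]setTI.
  by apply: (measurableT_comp (measurable_abs_powR q) (measurable_tnth i)).
apply: (le_trans (prob_le_prod (f := fun=> f) (c := fun=> L)
  (C := expR (n%:R / p - th * (n%:R * (m + b)))) n0 mF (expR_ge0 _) (fun=> iL) _)).
  move=> y /= yp [yq yx].
  have -> : \prod_(i < n) f (tnth y i) = expR (- (powsum p y / p) + th * powsum q y).
    transitivity (\prod_(i < n) (gdens p 0 1 (tnth y i) * expR (th * `|tnth y i| `^ q))).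
      by apply: eq_bigr => i _; rewrite /f yx.
    rewrite big_split/= (@prod_gdens0 _ p 1 n y (fun=> 1))// mul1r expRD; congr (_ * _).
    by rewrite -expR_sum -mulr_sumr.
  rewrite -expRD -[leLHS]expR0 ler_expR.
  have h1 : powsum p y / p <= n%:R / p by rewrite ler_pM2r ?invr_gt0.
  have h2 : th * (n%:R * (m + b)) <= th * powsum q y by rewrite ler_wpM2l// ltW.
  lra.
rewrite ler_wpM2l ?(ltW (poly_factor_gt0 n))// prodr_const card_ord.
rewrite ler_pdivrMr ?mulr_gt0 ?exprn_gt0 ?expR_gt0//.
have Lc : L <= c0 * expR (th * m + s ^+ 2 * (G2 / c0)).
  apply: (@le_trans _ _ (c0 * (1 + (th * m + s ^+ 2 * (G2 / c0))))); last first.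
    by rewrite ler_pM2l// expR_ge1Dx.
  apply: (le_trans L_le).
  have -> : c0 * (1 + (th * m + s ^+ 2 * (G2 / c0))) = c0 + th * gint p q 1 + s ^+ 2 * G2.
    by field; rewrite gt_eqF.
  rewrite lerD2l ler_pM2r// ler_pXn2r// nnegrE ltW//.
have L0 : 0 <= L by exact: isint_ge0 iL.
have := lerXn2r n L0 (mulr_ge0 (ltW c0_gt0) (expR_ge0 _)) Lc.
rewrite exprMn -expRM_natr => hL.
apply: (le_trans (ler_wpM2l (expR_ge0 _) hL)).
rewrite [leLHS](_ : _ = c0 ^+ n * (expR (n%:R / p - th * (n%:R * (m + b))) *
   expR ((th * m + s ^+ 2 * (G2 / c0)) * n%:R))); last by ring.
rewrite -!expRD [leRHS](_ : _ = c0 ^+ n * (expR (G2 / c0 * (n%:R * s ^+ 2) - (1 - d) * x `^ al / p)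
  * expR (n%:R / p))); last by ring.
rewrite ler_pM2l ?exprn_gt0// -!expRD ler_expR.
(* The reason for truncating at x = n b: slope times excess is then exactly the cost of one large
   coordinate. *)
have -> : (1 - d) * x `^ al / p = th * (n%:R * b).
  by rewrite -xE -(@mulr_powRB1 _ x al)// ?ltW// /th /s; ring.
lra.
Qed.

End tails.

(** * Asymptotic tail estimates *)

Section growth.
Context {R : realType}.

Lemma ler_powR2 (r x y : R) : 0 <= r -> 0 <= x -> x <= y -> x `^ r <= y `^ r.
Proof.
move=> r0 x0 xy; apply: ge0_ler_powR => //; rewrite nnegrE//.
exact: le_trans xy.
Qed.

Lemma powRV (x a : R) : 0 <= x -> x^-1 `^ a = (x `^ a)^-1.
Proof. by move=> x0; rewrite -powR_inv1// -powRrM mulN1r powRN. Qed.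

Lemma near_powR_ge (a M : R) : 0 < a -> \forall n \near \oo, M <= n%:R `^ a.
Proof.
move=> a0; pose r := (Num.max M 1) `^ a^-1.
have M1 : 0 < Num.max M 1 by rewrite lt_max ltr01 orbT.
near=> n.
apply: (@le_trans _ _ (r `^ a)).
  by rewrite /r -powRrM mulVf ?gt_eqF// powRr1 ?(ltW M1)// le_max lexx.
apply: ge0_ler_powR; rewrite ?nnegrE ?powR_ge0// ?(ltW a0)//.
by near: n; exact: nbhs_infty_ger.
Unshelve. all: by end_near. Qed.

(** One half of the exponent absorbs n^k, written as (n^a)^(k / a), the other half absorbs the
    constant. *)
Lemma near_poly_le_expR (C a e : R) (k : nat) : 0 < a -> 0 < e ->
  \forall n \near \oo, C * n%:R ^+ k <= expR (e * n%:R `^ a).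
Proof.
move=> a0 e0; have e20 : 0 < e / 2 by rewrite divr_gt0.
have ka0 : 0 <= k%:R / a by rewrite divr_ge0// ltW.
have [B B0 HB] := powR_le_expR ka0 e20.
near=> n.
have h1 : n%:R ^+ k <= B * expR (e / 2 * n%:R `^ a).
  apply: le_trans (HB _ (powR_ge0 _ _)).
  by rewrite -powRrM mulrCA divff ?gt_eqF// mulr1 powR_mulrn.
have h2 : `|C| * B <= expR (e / 2 * n%:R `^ a).
  apply: (@le_trans _ _ (e / 2 * n%:R `^ a)); last first.
    by apply: le_trans (expR_ge1Dx _); rewrite lerDr.
  by rewrite -ler_pdivrMl//; near: n; exact: near_powR_ge.
apply: (@le_trans _ _ (`|C| * n%:R ^+ k)).
  by rewrite ler_wpM2r ?exprn_ge0// ler_norm.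
apply: (le_trans (ler_wpM2l (normr_ge0 C) h1)).
have -> : e * n%:R `^ a = e / 2 * n%:R `^ a + e / 2 * n%:R `^ a by field.
by rewrite mulrA expRD ler_wpM2r ?expR_ge0.
Unshelve. all: by end_near. Qed.

(** Lets the lower bound be proved in dimension n + 1: one large coordinate and n typical ones. *)
Lemma near_succ (P : nat -> Prop) :
  (\forall n \near \oo, P n.+1) -> \forall n \near \oo, P n.
Proof. by move=> [N _ H]; exists N.+1 => // -[//|n] /= Nn; exact: H. Qed.

Lemma cvg_succ_powR0 (a : R) : a < 0 -> (n.+1%:R : R) `^ a @[n --> \oo] --> 0.
Proof.
move=> a0; apply/cvgrPdist_le => e e0.
have a0' : 0 < - a by rewrite oppr_gt0.
have [N _ H] := near_powR_ge e^-1 a0'.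
exists N => // n /= Nn; rewrite sub0r normrN ger0_norm ?powR_ge0//.
rewrite -(opprK a) powRN -(invrK e) lef_pV2 ?posrE ?invr_gt0 ?powR_gt0//.
by apply: H => /=; rewrite (leq_trans Nn).
Qed.

Lemma cvg_ratio_succ : (n%:R / n.+1%:R : R) @[n --> \oo] --> (1 : R).
Proof.
have -> : (fun n => n%:R / n.+1%:R : R) = (fun n => 1 - harmonic n).
  apply/funext => n; rewrite /harmonic/= -[X in X - _](@divff _ (n.+1%:R : R))//.
  by rewrite -[X in _ - X]mul1r -mulrBl -natr1 addrK.
rewrite -[X in _ --> X]subr0; apply: cvgB; [exact: cvg_cst|exact: cvg_harmonic].
Qed.

End growth.

Section tails_near.
Context {R : realType} (p q : R).
Hypotheses (p1 : 1 <= p) (pq : p < q).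
Let p0 : 0 < p. Proof. exact: lt_le_trans p1. Qed.
Let q0 : 0 < q. Proof. exact: lt_trans pq. Qed.
Local Notation c0 := (gint p 0 1).
Local Notation m := (gint p q 1 / gint p 0 1).
Local Notation al := (p / q).
Local Notation P := (prob p).
Let c0_gt0 : 0 < c0. Proof. exact: gint_gt0. Qed.
Let al_gt0 : 0 < al. Proof. exact: divr_gt0. Qed.
Let al_lt1 : al < 1. Proof. by rewrite ltr_pdivrMr// mul1r. Qed.

Lemma poly_factor_le n : (0 < n)%N ->
  poly_factor p n <= 2 * expR p^-1 * (1 + 2 * p) ^+ 2 * n%:R ^+ 2.
Proof.
move=> n0; rewrite /poly_factor -[leRHS]mulrA -exprMn ler_pM2l ?mulr_gt0 ?expR_gt0//.
have n1 : (1 : R) <= n%:R by rewrite ler1n.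
apply: lerXn2r; rewrite ?nnegrE ?mulr_ge0 ?addr_ge0 ?mulr_ge0 ?(ltW p0)//.
by rewrite [leRHS]mulrDl mul1r lerD2l ler_peMr// mulr_ge0// ltW.
Qed.

(** The surplus n^(1 - p/q) over the speed tends to infinity; it is what beats constants and error
    terms. *)
Lemma natr_split n : (0 < n)%N -> (n%:R : R) = n%:R `^ al * n%:R `^ (1 - al).
Proof.
move=> n0; rewrite -powRD; last by rewrite pnatr_eq0 -lt0n n0 implybT.
by rewrite addrC subrK powRr1.
Qed.

Lemma lower_tail_near (e M : R) : 0 < e -> \forall n \near \oo,
  @P n [set y | powsum q y <= n%:R * (m - e)] <= expR (- (M * n%:R `^ al)).
Proof.
move=> e0; have [k k0 Hk] := lower_tail p1 pq e0.
pose C : R := 2 * expR p^-1 * (1 + 2 * p) ^+ 2.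
near=> n; have n0 : (0 < n)%N by near: n; exact: nbhs_infty_gt.
apply: (le_trans (Hk n n0)).
have h1 : poly_factor p n <= expR (1 * n%:R `^ al).
  by apply: le_trans (poly_factor_le n0) _; near: n; exact: near_poly_le_expR.
apply: (le_trans (ler_wpM2r (expR_ge0 _) h1)).
rewrite -expRD ler_expR {2}(natr_split n0).
have h2 : (M + 1) / k <= n%:R `^ (1 - al).
  by near: n; apply: near_powR_ge; rewrite subr_gt0.
rewrite ler_pdivrMr// in h2.
have := ler_wpM2l (powR_ge0 (n%:R : R) al) h2.
set A := _ `^ al; set B := _ `^ (1 - al) => h3; lra.
Unshelve. all: by end_near. Qed.

Lemma upper_tail_near (b e : R) : 0 < b -> 0 < e -> \forall n \near \oo,
  @P n [set y | n%:R * (m + b) <= powsum q y] <=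
  expR (- (n%:R `^ al * (b `^ al / p - e))).
Proof.
move=> b0 e0; have ba0 : 0 < b `^ al by rewrite powR_gt0.
have aux (N B s : R) : 0 <= N -> 0 <= s ->
    s * N + s * N - N * (B - s) <= - (N * (B - 4 * s)).
  by move=> N0 s0; have := mulr_ge0 N0 s0; lra.
(* Error budget: one share each for the polynomial factor, the quadratic remainder of the Chernoff
   bound, and the loss d b^(p/q) / p caused by the choice of [d]. *)
pose e4 := e / 4; have e40 : 0 < e4 by rewrite divr_gt0.
pose d := Num.min (1 / 2) (e4 * p / b `^ al).
have d0 : 0 < d by rewrite lt_min divr_gt0// divr_gt0// mulr_gt0.
have d1 : d < 1 by rewrite gt_min; apply/orP; left; lra.
have db : d * b `^ al / p <= e4.
  by rewrite ler_pdivrMr// -ler_pdivlMr// ge_min lexx orbT.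
pose K := gint p (2 * q) d / c0.
have K0 : 0 < K by rewrite divr_gt0// gint_gt0// mulr_ge0// ltW.
pose C1 := gint p 0 d / c0; have C10 : 0 < C1 by rewrite divr_gt0// gint_gt0.
pose C : R := 2 * expR p^-1 * (1 + 2 * p) ^+ 2.
have C0 : 0 <= C by rewrite mulr_ge0 ?sqr_ge0// mulr_ge0 ?expR_ge0.
near=> n; have n0 : (0 < n)%N by near: n; exact: nbhs_infty_gt.
have n0' : (0 : R) < n%:R by rewrite ltr0n.
have n1 : (1 : R) <= n%:R by rewrite ler1n.
pose x := n%:R * b; have x0 : 0 < x by rewrite mulr_gt0.
have xal : x `^ al = n%:R `^ al * b `^ al by rewrite powRM// ltW.
pose A := [set y : n.-tuple R | n%:R * (m + b) <= powsum q y /\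
   forall i : 'I_n, `|tnth y i| `^ q <= x].
pose Bi (i : 'I_n) := [set y : n.-tuple R | x < `|tnth y i| `^ q].
have mBi i : measurable (Bi i).
  rewrite (_ : Bi i = (fun y : n.-tuple R => `|tnth y i| `^ q) @^-1` `]x, +oo[); last first.
    by apply/seteqP; split => y; rewrite /Bi /= in_itv/= andbT.
  rewrite -[X in measurable X]setTI.
  apply: (measurableT_comp (measurable_abs_powR q) (measurable_tnth i)) => //.
have mF : measurable [set y : n.-tuple R | n%:R * (m + b) <= powsum q y].
  rewrite (_ : [set _ | _] = [set y : n.-tuple R | `[n%:R * (m + b), +oo[%classic (powsum q y)]).
    by apply: measurable_powsum_preimage; exact: measurable_itv.
  by apply/seteqP; split => y; rewrite /= in_itv/= andbT.
pose U := \big[setU/set0]_(i <- enum 'I_n) Bi i.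
have mU : measurable U by apply: bigsetU_measurable => i _; exact: mBi.
have AE : A = [set y : n.-tuple R | n%:R * (m + b) <= powsum q y] `\` U.
  apply/seteqP; split => y.
    move=> [h1 h2]; split => //; rewrite /U -bigcup_seq => -[i _].
    by rewrite /Bi/= ltNge h2.
  move=> [h1 h2]; split => // i; rewrite leNgt; apply/negP => h3; apply: h2.
  by rewrite /U -bigcup_seq; exists i => //=; rewrite mem_enum.
have mA : measurable A by rewrite AE; exact: measurableD.
have FU : [set y : n.-tuple R | n%:R * (m + b) <= powsum q y] `<=` U `|` A.
  by move=> y Fy; have [Uy|Uy] := pselect (U y); [left|right; rewrite AE].
apply: (le_trans (le_prob p1 mF (measurableU _ _ mU mA) FU)).
apply: (le_trans (probU_le p1 mU mA)).
set E := expR (- ((1 - d) * x `^ al / p)).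
have hU : P U <= n%:R * (poly_factor p n * (C1 * E)).
  apply: (le_trans (prob_bigU_le p1 _ mBi (fun i => single_big_coord p1 pq i d0 d1 x0))).
  by rewrite big_enum/= sumr_const card_ord mulr_natl.
have hA := truncated_tail p1 pq n0 d0 d1 b0 (erefl x).
rewrite -/A -/E -/K in hA.
apply: (le_trans (lerD hU hA)).
(* The remainder n x^(2 (p/q - 1)) has order n^(2 p/q - 1), smaller than the speed by the factor
   n^(1 - p/q). *)
have hK : K * (n%:R * (x `^ (al - 1)) ^+ 2) <= e4 * n%:R `^ al.
  have -> : n%:R * (x `^ (al - 1)) ^+ 2 = b^-1 * b `^ al * n%:R `^ al * x `^ (al - 1).
    have h : x * x `^ (al - 1) = n%:R `^ al * b `^ al by rewrite mulr_powRB1// ltW.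
    transitivity (b^-1 * (n%:R `^ al * b `^ al) * x `^ (al - 1)); last by ring.
    rewrite -h; move: (x `^ (al - 1)) => s; rewrite /x.
    by field; rewrite gt_eqF.
  have -> : x `^ (al - 1) = (n%:R `^ (1 - al) * b `^ (1 - al))^-1.
    by rewrite -powRM ?(ltW b0)// -powRN opprB.
  have : K * b^-1 * b `^ al / b `^ (1 - al) / e4 <= n%:R `^ (1 - al).
    by near: n; apply: near_powR_ge; rewrite subr_gt0.
  have na0 : 0 < (n%:R : R) `^ (1 - al) by rewrite powR_gt0.
  have na1 : 0 < b `^ (1 - al) by rewrite powR_gt0.
  rewrite ler_pdivrMr// -ler_pdivrMl// => h.
  have := ler_wpM2l (powR_ge0 (n%:R : R) al) h.
  rewrite invfM; set B := _ `^ (1 - al); set D := b `^ (1 - al); set N := n%:R `^ al.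
  by rewrite (mulrC e4); apply: le_trans; rewrite le_eqVlt; apply/orP; left; apply/eqP; ring.
have E_le : E <= expR (- (n%:R `^ al * (b `^ al / p - e4))).
  rewrite /E ler_expR lerN2 xal.
  have := ler_wpM2l (powR_ge0 (n%:R : R) al) db; lra.
have h1 : (poly_factor p n * (n%:R * C1 + 1)) <= expR (e4 * n%:R `^ al).
  apply: (@le_trans _ _ (C * (C1 + 1) * n%:R ^+ 3)); last first.
    by near: n; exact: near_poly_le_expR.
  apply: (@le_trans _ _ (C * n%:R ^+ 2 * (n%:R * (C1 + 1)))).
    apply: ler_pM; rewrite ?(ltW (poly_factor_gt0 p1 n))// ?poly_factor_le//.
      by rewrite addr_ge0// mulr_ge0// ltW.
    by rewrite mulrDr mulr1 lerD2l.
  by rewrite le_eqVlt; apply/orP; left; apply/eqP; ring.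
set X := expR (K * _) in hA *.
have X1 : 1 <= X by rewrite /X -[leLHS]expR0 ler_expR mulr_ge0 ?(ltW K0)// mulr_ge0// sqr_ge0.
have X2 : X <= expR (e4 * n%:R `^ al) by rewrite /X ler_expR.
have P0 := poly_factor_gt0 p1 n.
have E0 : 0 < E by exact: expR_gt0.
apply: (@le_trans _ _ (poly_factor p n * (n%:R * C1 + 1) * X * E)).
  have : poly_factor p n * n%:R * C1 * E * 1 <= poly_factor p n * n%:R * C1 * E * X.
    apply: ler_wpM2l X1.
    exact: mulr_ge0 (mulr_ge0 (mulr_ge0 (ltW P0) (ltW n0')) (ltW C10)) (ltW E0).
  lra.
apply: (@le_trans _ _ (expR (e4 * n%:R `^ al) * expR (e4 * n%:R `^ al) *
    expR (- (n%:R `^ al * (b `^ al / p - e4))))).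
  have X0 : 0 <= X by rewrite (le_trans _ X1).
  have Y0 : 0 <= poly_factor p n * (n%:R * C1 + 1).
    by rewrite mulr_ge0 ?(ltW P0)// addr_ge0// mulr_ge0// ltW.
  exact: (ler_pM (mulr_ge0 Y0 X0) (ltW E0) (ler_pM Y0 X0 h1 X2) E_le).
rewrite -!expRD ler_expR.
have eE : e = 4 * e4 by rewrite /e4; field.
rewrite [in leRHS]eE; apply: aux; [exact: powR_ge0|exact: ltW].
Unshelve. all: by end_near. Qed.

End tails_near.

(** * The lower bound *)

Section lower_bound.
Context {R : realType} (p q : R).
Hypotheses (p1 : 1 <= p) (pq : p < q).
Local Notation leb := (@lebesgue_measure R).
Let p0 : 0 < p. Proof. exact: lt_le_trans p1. Qed.
Let q0 : 0 < q. Proof. exact: lt_trans pq. Qed.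
Local Notation m := (gint p q 1 / gint p 0 1).
Local Notation al := (p / q).
Local Notation P := (prob p).
Let al_gt0 : 0 < al. Proof. exact: divr_gt0. Qed.
Let al_lt1 : al < 1. Proof. by rewrite ltr_pdivrMr// mul1r. Qed.
Let m_gt0 : 0 < m. Proof. by rewrite divr_gt0// gint_gt0// ltW. Qed.

Lemma measurable_near_mean n (u e : R) :
  measurable [set y : n.-tuple R | `|powsum q y - u| < e].
Proof.
rewrite (_ : [set _ | _] = [set y : n.-tuple R | `]u - e, u + e[%classic (powsum q y)]).
  by apply: measurable_powsum_preimage; exact: measurable_itv.
by apply/seteqP; split => y; rewrite /= in_itv/= ltr_distl.
Qed.

Lemma probT n : (0 < n)%N -> @P n setT = 1.
Proof. by move=> n0; rewrite /prob setIT divff// gt_eqF// rvol_pball_gt0. Qed.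

(** A weak law of large numbers for the uniform law, read off from the two tail bounds, each made at
    most 1/4. The constant 1/2 disappears on the logarithmic scale. *)
Lemma typical_near (e : R) : 0 < e -> \forall n \near \oo,
  1 / 2 <= @P n [set y | `|powsum q y - n%:R * m| < n%:R * e].
Proof.
move=> e0; have ea0 : 0 < e `^ al / p by rewrite divr_gt0// powR_gt0.
near=> n; have n0 : (0 < n)%N by near: n; exact: nbhs_infty_gt.
have hL0 : @P n [set y | powsum q y <= n%:R * (m - e)] <= expR (- (1 * n%:R `^ al)).
  by near: n; exact: lower_tail_near.
have hH0 : @P n [set y | n%:R * (m + e) <= powsum q y] <=
    expR (- (n%:R `^ al * (e `^ al / p - (e `^ al / p) / 2))).
  by near: n; apply: upper_tail_near => //; rewrite divr_gt0.
have n4 : 4 <= n%:R `^ al by near: n; exact: near_powR_ge.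
have n4' : 4 / (e `^ al / p / 2) <= n%:R `^ al by near: n; exact: near_powR_ge.
pose L := [set y : n.-tuple R | powsum q y <= n%:R * (m - e)].
pose H := [set y : n.-tuple R | n%:R * (m + e) <= powsum q y].
set T := [set y | _].
have mT : measurable T by exact: measurable_near_mean.
have mL : measurable L by exact: (@measurable_pball R q n).
have mH : measurable H.
  rewrite (_ : H = [set y : n.-tuple R | `[n%:R * (m + e), +oo[%classic (powsum q y)]).
    by apply: measurable_powsum_preimage; exact: measurable_itv.
  by apply/seteqP; split => y; rewrite /= in_itv/= andbT.
have cover : (setT : set (n.-tuple R)) `<=` T `|` (L `|` H).
  move=> y _; have [h1|h1] := leP (powsum q y) (n%:R * (m - e)); first by right; left.
  have [h2|h2] := leP (n%:R * (m + e)) (powsum q y); first by right; right.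
  by left; rewrite /T/= ltr_distl -mulrBr h1 -mulrDr h2.
have h := le_prob p1 measurableT (measurableU _ _ mT (measurableU _ _ mL mH)) cover.
rewrite probT// in h.
have h1 := probU_le p1 mT (measurableU _ _ mL mH).
have h2 := probU_le p1 mL mH.
have quarter (x : R) : 4 <= x -> expR (- x) <= 1 / 4.
  move=> x4; rewrite expRN div1r lef_pV2 ?posrE ?expR_gt0//.
  by apply: le_trans (expR_ge1Dx _); lra.
have hL : P L <= 1 / 4.
  by apply: (le_trans hL0); apply: quarter; rewrite mul1r.
have hH : P H <= 1 / 4.
  apply: (le_trans hH0); apply: quarter.
  have -> : e `^ al / p - e `^ al / p / 2 = e `^ al / p / 2 by field; rewrite gt_eqF.
  by rewrite -ler_pdivrMr// divr_gt0.
lra.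
Unshelve. all: by end_near. Qed.

(** The unit ball lies in the product of [-1, 1] with the unit ball one dimension lower. This
    relates the normalizations in dimensions n and n + 1 without any Gamma ratio. *)
Lemma rvol_unit_succ n : rvol (@pball R p n.+1 1) <= 2 * rvol (@pball R p n 1).
Proof.
rewrite -lee_fin EFinM -(rvolE p1 (t := 1) (@measurable_pball R p n 1))//.
rewrite -(rvolE p1 (t := 1) (@measurable_pball R p n.+1 1))// vol_cons.
apply: (@le_trans _ _ (\int[leb]_(x in `[(-1)%R, 1%R]) cst (vol (@pball R p n 1)) x)%E).
  rewrite [leRHS]integral_mkcond; apply: ge0_le_integral.
  - exact: measurableT.
  - by move=> x _; exact: vol_ge0.
  - by apply: measurable_fun_slice; exact: measurable_pball.
  - apply/(measurable_restrictT _ _).1; first exact: measurable_itv.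
    exact: measurable_cst.
  - move=> x _; rewrite patchE; case: ifPn => [_|].
      rewrite le_measure ?inE//.
      + by apply: measurable_slice; exact: measurable_pball.
      + exact: measurable_pball.
      + move=> t; rewrite /pball/= powsum_cons; apply: le_trans.
        by rewrite lerDr powR_ge0.
    rewrite notin_setE/= in_itv/= -ler_norml => x1.
    rewrite (_ : [set _ | _] = set0) ?measure0//; apply/seteqP; split => t //=.
    rewrite /pball/= powsum_cons => h; apply: x1.
    have h1 : `|x| `^ p <= 1 by rewrite (le_trans _ h)// lerDl powsum_ge0.
    rewrite leNgt; apply/negP => x1.
    have : `|x| <= `|x| `^ p by apply: le1r_powR => //; exact: ltW.
    by move=> /le_trans/(_ h1); rewrite leNgt x1.
rewrite integral_cst; last exact: measurable_itv.
rewrite muleC; apply: lee_wpmul2r; first exact: vol_ge0.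
by rewrite [leLHS](lebesgue_measure_itv `[(-1)%R : R, 1%R])/= lte_fin; case: ifP => _;
  rewrite -?EFinD lee_fin; lra.
Qed.

Lemma rvol_slab n t (l1 l2 : R) (T : set (n.-tuple R)) (A : set (n.+1.-tuple R)) :
  l1 <= l2 -> measurable T -> measurable A -> A `<=` pball p t -> T `<=` pball p t ->
  (forall x y, l1 <= x <= l2 -> T y -> A (cons_tuple x y)) ->
  (l2 - l1) * rvol T <= rvol A.
Proof.
move=> l12 mT mA At Tt H; rewrite -lee_fin EFinM -(rvolE p1 mT Tt) -(rvolE p1 mA At).
have -> : ((l2 - l1)%:E * vol T = \int[leb]_(x in `[l1, l2]) cst (vol T) x)%E.
  rewrite integral_cst; last exact: measurable_itv.
  rewrite muleC; congr (_ * _)%E; apply/esym.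
  rewrite [LHS](lebesgue_measure_itv `[l1, l2])/= lte_fin.
  by move: l12; rewrite le_eqVlt => /predU1P[->|->//]; rewrite ltxx subrr.
rewrite vol_cons integral_mkcond; apply: ge0_le_integral.
- exact: measurableT.
- by move=> x _; apply: erestrict_ge0 => y _; exact: vol_ge0.
- apply/(measurable_restrictT _ _).1; first exact: measurable_itv.
  exact: measurable_cst.
- exact: measurable_fun_slice.
- move=> x _; rewrite patchE; case: ifPn => [|_]; last exact: vol_ge0.
  rewrite inE/= in_itv/= => xl; rewrite le_measure ?inE//.
    exact: measurable_slice.
  by move=> y Ty; exact: H.
Qed.

(* One coordinate carries the excess [n b]; the others stay typical. *)
Lemma spike_le (b e : R) (n : nat) (rho : R) : (0 < n)%N -> 0 < b -> 0 < e ->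
  let N : R := n.+1%:R in
  rho = N - (N * b) `^ al -> 0 < rho ->
  `|(rho / n%:R) `^ (q / p) * n%:R - N| <= N * ((e / 4) / (e / 4 + m)) ->
  1 / 2 <= @P n [set y | `|powsum q y - n%:R * m| < n%:R * (e / 4)] ->
  (b `^ q^-1 - (b - Num.min b e / 2) `^ q^-1) / 4 * N^-1 * (rho / N) `^ (n%:R / p) <=
  @P n.+1 [set y | `|powsum q y - N * (m + b)| < N * e].
Proof.
move=> n0 b0 e0 N rhoE rho0 hk hT.
have n0' : (0 : R) < n%:R by rewrite ltr0n.
have N0 : 0 < N by rewrite /N ltr0n.
have N1 : 1 <= N by rewrite /N ler1n.
have nN : (n%:R : R) <= N by rewrite /N ler_nat.
(* Keeps b - e' positive and spends at most half of the tolerance on the large coordinate; the other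
   half is left to the remaining coordinates. *)
pose e' := Num.min b e / 2.
have e'0 : 0 < e' by rewrite divr_gt0// lt_min b0.
have e'b : e' < b.
  by rewrite /e' ltr_pdivrMr// gt_min; apply/orP; left; lra.
have e'e : e' <= e / 2 by rewrite /e' ler_pM2r ?invr_gt0// ge_min lexx orbT.
pose l1 := (N * (b - e')) `^ q^-1; pose l2 := (N * b) `^ q^-1.
have qi : 0 <= q^-1 by rewrite invr_ge0 ltW.
have be'0 : 0 < b - e' by rewrite subr_gt0.
have l12 : l1 <= l2.
  by apply: ge0_ler_powR; rewrite ?nnegrE ?mulr_ge0 ?(ltW N0) ?(ltW b0) ?(ltW be'0)// ler_pM2l// gerBl ltW.
have powq (u : R) : 0 <= u -> (u `^ q^-1) `^ q = u.
  by move=> u0; rewrite -powRrM mulVf ?gt_eqF// powRr1.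
pose T := [set t : n.-tuple R | powsum p t <= rho /\ `|powsum q t - N * m| < N * (e / 2)].
set F := [set y | _].
have mT : measurable T.
  by apply: measurableI; [exact: (@measurable_pball R p n)|exact: measurable_near_mean].
have mF : measurable F by exact: measurable_near_mean.
have mD k (t : R) := @measurable_pball R p k t.
have rhoN : rho <= N by rewrite rhoE gerBl powR_ge0.
have slab : (l2 - l1) * rvol T <= rvol (@pball R p n.+1 N `&` F).
  apply: (rvol_slab (t := N)) => //; first exact: measurableI.
    by move=> t [h _]; exact: le_trans h rhoN.
  move=> x t /andP[x1 x2] [tp tq].
  have x0 : 0 <= x by rewrite (le_trans _ x1)// powR_ge0.
  have xq2 : x `^ q <= N * b.
    rewrite -[leRHS]powq ?mulr_ge0 ?(ltW N0) ?(ltW b0)//.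
    by apply: ge0_ler_powR; rewrite ?nnegrE ?powR_ge0 ?(ltW q0).
  have xq1 : N * (b - e') <= x `^ q.
    rewrite -[leLHS]powq ?mulr_ge0 ?(ltW N0) ?(ltW be'0)//.
    by apply: ge0_ler_powR; rewrite ?nnegrE ?powR_ge0 ?(ltW q0).
  split.
    rewrite /pball/= powsum_cons (ger0_norm x0) -(powR_al p1 pq x).
    have : (x `^ q) `^ al <= (N * b) `^ al.
      by apply: ler_powR2 => //; [exact: ltW|exact: powR_ge0].
    move: tp; rewrite rhoE; lra.
  rewrite /F/= powsum_cons (ger0_norm x0).
  move: tq; rewrite !ltr_distl => /andP[t1 t2].
  have h : N * e' <= N * (e / 2) by rewrite ler_pM2l.
  move: (powsum q t) (x `^ q) t1 t2 xq1 xq2 => S X t1 t2 xq1 xq2.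
  by apply/andP; split; lra.
pose T' := @pball R p n n%:R `&` [set y | `|powsum q y - n%:R * m| < n%:R * (e / 4)].
have mT' : measurable T' by apply: measurableI => //; exact: measurable_near_mean.
(* Scaling by [r] maps the ball of parameter [rho] onto the one of parameter n, where typicality is
   known; q-th power sums get divided by [k], and [hk] says that k n is close to N. *)
pose r := (n%:R / rho) `^ p^-1.
have r0 : 0 < r by rewrite powR_gt0// divr_gt0.
have rpE : r `^ p = n%:R / rho.
  by rewrite /r -powRrM mulVf ?gt_eqF// powRr1// divr_ge0// ltW.
pose k := (rho / n%:R) `^ (q / p).
have k0 : 0 < k by rewrite powR_gt0// divr_gt0.
have rqE : r `^ q = k^-1.
  by rewrite /r /k -powRrM (mulrC p^-1) -invf_div powRV// divr_ge0// ltW.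
have T'T : [set t | T' (scale_tuple r t)] `<=` T.
  move=> t [h1 h2]; rewrite /pball/= powsum_scale ?(ltW r0)// rpE in h1.
  rewrite /= powsum_scale ?(ltW r0)// rqE in h2.
  split.
    by move: h1; rewrite mulrAC ler_pdivrMr// ler_pM2l.
  set S := powsum q t in h2 *.
  have e40 : 0 < e / 4 by rewrite divr_gt0.
  have h3 : `|S - k * (n%:R * m)| < k * (n%:R * (e / 4)).
    have -> : S - k * (n%:R * m) = k * (k^-1 * S - n%:R * m).
      by rewrite mulrBr mulVKf// gt_eqF.
    by rewrite normrM (gtr0_norm k0) ltr_pM2l.
  have em0 : 0 < e / 4 + m by rewrite addr_gt0.
  (* Chosen so that tau (e / 4 + m) = e / 4: the tolerance (1 + tau) e / 4 and the shift tau m of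
     the mean then add up to e / 2. *)
  pose tau := (e / 4) / (e / 4 + m).
  have tauE : tau * (e / 4) + tau * m = e / 4 by rewrite -mulrDr divfK// gt_eqF.
  have h4 : `|k * (n%:R * m) - N * m| <= N * (tau * m).
    have -> : k * (n%:R * m) - N * m = (k * n%:R - N) * m by ring.
    by rewrite normrM (gtr0_norm m_gt0) mulrA ler_pM2r.
  have h5 : k * n%:R <= N + N * tau by have := ler_normlW hk; rewrite -/tau -/k; lra.
  have h6 : k * n%:R * (e / 4) <= (N + N * tau) * (e / 4) by rewrite ler_pM2r.
  apply: (@le_lt_trans _ _ (`|S - k * (n%:R * m)| + `|k * (n%:R * m) - N * m|)).
    have -> : S - N * m = S - k * (n%:R * m) + (k * (n%:R * m) - N * m) by ring.
    exact: ler_normD.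
  have h7 : N * (tau * (e / 4) + tau * m) = N * (e / 4) by rewrite tauE.
  move: h3 h4 h6 h7.
  move: `|S - _| `|_ - N * m| => A B h3 h4 h6 h7; lra.
have mT'r : measurable [set t | T' (scale_tuple r t)].
  by rewrite -[X in measurable X]setTI; exact: measurable_scale_tuple.
have TV : r^-1 ^+ n * rvol T' <= rvol T.
  by rewrite -rvol_scale//; apply: (le_rvol p1 (t := rho)) => // t [].
have hD : 1 / 2 * rvol (@pball R p n n%:R) <= rvol T'.
  by rewrite -ler_pdivlMr ?rvol_pball_gt0.
rewrite /prob; have DN := rvol_pball_gt0 p1 (ltn0Sn n).
rewrite -/N ler_pdivlMr//.
apply: le_trans slab.
set v := rvol (@pball R p n 1).
have v0 : 0 <= v by exact: rvol_ge0.
have dn : rvol (@pball R p n n%:R) = n%:R `^ (n%:R / p) * v by exact: rvol_pball.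
(* The volume [v] cancels in the quotient. The denominator 4 collects the 1/2 from typicality and
   this 2, and the leftover N^(1/p) is at most N, whence N^-1 in the statement. *)
have dN : rvol (@pball R p n.+1 N) <= N `^ (N / p) * (2 * v).
  rewrite rvol_pball// ler_wpM2l ?powR_ge0//; exact: rvol_unit_succ.
have NpE : N `^ (N / p) = N `^ (n%:R / p) * N `^ p^-1.
  rewrite -powRD; last by rewrite (gt_eqF N0) implybT.
  by rewrite /N -natr1 mulrDl mul1r.
have rn : r^-1 ^+ n = rho `^ (n%:R / p) / n%:R `^ (n%:R / p).
  rewrite -powR_mulrn ?invr_ge0 ?(ltW r0)// powRV ?(ltW r0)// /r -powRrM.
  rewrite (mulrC p^-1) -powRV ?divr_ge0 ?(ltW rho0)// invf_div.
  by rewrite powRM ?invr_ge0 ?(ltW rho0)// powRV.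
have NNp : N `^ p^-1 <= N.
  by rewrite -[leRHS]powRr1 ?(ltW N0)// ler_powR// invf_le1.
have d12 : l2 - l1 = N `^ q^-1 * (b `^ q^-1 - (b - e') `^ q^-1).
  by rewrite /l1 /l2 !powRM ?(ltW N0) ?(ltW b0) ?(ltW be'0)// mulrBr.
set c := b `^ q^-1 - (b - e') `^ q^-1 in d12 *.
have c_ge0 : 0 <= c.
  rewrite subr_ge0; apply: ge0_ler_powR; rewrite ?nnegrE ?(ltW b0) ?(ltW be'0)//.
  by rewrite gerBl ltW.
have Nq : 1 <= N `^ q^-1 by rewrite -(powRr0 N) ler_powR.
have np0 : 0 < (n%:R : R) `^ (n%:R / p) by rewrite powR_gt0.
have Np0 : 0 < N `^ (n%:R / p) by rewrite powR_gt0.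
have rp0 : 0 <= rho `^ (n%:R / p) by exact: powR_ge0.
apply: (@le_trans _ _ (c * (rho `^ (n%:R / p) * (1 / 2 * v)))); last first.
  apply: ler_pM => //.
  - by rewrite mulr_ge0// mulr_ge0.
  - by rewrite d12 ler_peMl.
  - apply: le_trans TV; rewrite rn.
    apply: le_trans (ler_wpM2l _ hD); last by rewrite divr_ge0// ltW.
    rewrite dn le_eqVlt; apply/orP; left; apply/eqP.
    by field; rewrite gt_eqF.
have pf : 0 <= c / 4 * N^-1 * (rho / N) `^ (n%:R / p).
  by rewrite mulr_ge0 ?powR_ge0// mulr_ge0 ?invr_ge0 ?(ltW N0)// divr_ge0.
apply: (le_trans (ler_wpM2l pf dN)).
rewrite NpE powRM ?invr_ge0 ?(ltW rho0) ?(ltW N0)//.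
have -> : (N^-1) `^ (n%:R / p) = (N `^ (n%:R / p))^-1.
  by rewrite powRV// ltW.
have NV : N^-1 * N `^ p^-1 <= 1 by rewrite ler_pdivrMl// mulr1.
have := ler_wpM2l (mulr_ge0 c_ge0 (mulr_ge0 rp0 v0)) NV.
move: (rho `^ _) (N `^ (n%:R / p)) (N `^ p^-1) Np0 => X Y Z Y0 h.
rewrite [leLHS](_ : _ = (c * (X * v)) * (N^-1 * Z) / 2); last first.
  by field; rewrite !gt_eqF.
have -> : c * (X * (1 / 2 * v)) = c * (X * v) * 1 / 2 by field.
by rewrite ler_pM2r.
Qed.

Lemma lower_bound_near (b e h : R) : 0 < b -> 0 < e -> 0 < h -> \forall n \near \oo,
  expR (- (n%:R `^ al * (b `^ al / p + h))) <=
  @P n [set y | `|powsum q y - n%:R * (m + b)| < n%:R * e].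
Proof.
move=> b0 e0 h0; apply: near_succ.
pose e' := Num.min b e / 2.
have e'0 : 0 < e' by rewrite divr_gt0// lt_min b0.
have e'b : e' < b.
  by rewrite /e' ltr_pdivrMr// gt_min; apply/orP; left; lra.
pose c := b `^ q^-1 - (b - e') `^ q^-1.
have c0 : 0 < c.
  rewrite subr_gt0; apply: gt0_ltr_powR; rewrite ?nnegrE ?invr_gt0 ?(ltW b0)//.
    by rewrite subr_ge0 ltW.
  by rewrite gtrBl.
pose tau := (e / 4) / (e / 4 + m).
have e40 : 0 < e / 4 by rewrite divr_gt0.
have tau0 : 0 < tau by rewrite divr_gt0// addr_gt0.
have ba0 : 0 < b `^ al by rewrite powR_gt0.
(* The fraction of the ball parameter used up by the large coordinate, (N b)^(p/q) / N with N = n +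
   1. *)
pose u n := b `^ al * (n.+1%:R : R) `^ (al - 1).
have cu : u n @[n --> \oo] --> (0 : R).
  rewrite -(mulr0 (b `^ al)); apply: cvgM; first exact: cvg_cst.
  by apply: cvg_succ_powR0; rewrite subr_lt0.
pose v n := (n%:R / n.+1%:R : R).
have cv : v n @[n --> \oo] --> (1 : R) by exact: cvg_ratio_succ.
have c1u : 1 - u n @[n --> \oo] --> (1 - 0 : R).
  by apply: cvgB => //; exact: cvg_cst.
have cratio : ((1 - u n) / v n) `^ (q / p) * v n @[n --> \oo] --> (1 : R).
  have H1 : (1 - u n) / v n @[n --> \oo] --> ((1 - 0) / 1 : R).
    by apply: cvgM => //; apply: cvgV => //; exact: oner_neq0.
  rewrite subr0 divr1 in H1.
  have H2 : ((1 - u n) / v n) `^ (q / p) @[n --> \oo] --> ((1 : R) `^ (q / p)).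
    apply: (cvg_comp (fun n => (1 - u n) / v n) (fun x => x `^ (q / p)) H1).
    exact: continuous_powR.
  rewrite powR1/= in H2.
  have H3 := cvgM H2 cv; rewrite mulr1 in H3.
  exact: H3.
pose L := b `^ al / p.
have L0 : 0 < L by rewrite divr_gt0.
have cL : L / (1 - u n) @[n --> \oo] --> L.
  have H1 : L / (1 - u n) @[n --> \oo] --> (L / (1 - 0) : R).
    apply: cvgM; first exact: cvg_cst.
    by apply: cvgV => //; rewrite subr0 oner_neq0.
  by rewrite subr0 divr1 in H1.
have h20 : 0 < h / 2 by rewrite divr_gt0.
near=> n; have n0 : (0 < n)%N by near: n; exact: nbhs_infty_gt.
set N : R := n.+1%:R.
have n0' : (0 : R) < n%:R by rewrite ltr0n.
have N0 : 0 < N by rewrite /N ltr0n.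
have N1 : 1 <= N by rewrite /N ler1n.
pose rho := N - (N * b) `^ al.
have rhoE : rho = N * (1 - u n).
  have h1 : N * N `^ (al - 1) = N `^ al by rewrite mulr_powRB1// ltW.
  by rewrite /rho powRM ?(ltW N0) ?(ltW b0)// -h1 /u -/N; ring.
have un : u n < 1.
  near: n; exact: (cvgr_lt 0 cu 1 ltr01).
have un0 : 0 <= u n by rewrite mulr_ge0 ?powR_ge0.
have un1 : 0 < 1 - u n by rewrite subr_gt0.
have rho0 : 0 < rho by rewrite rhoE mulr_gt0.
have hk : `|(rho / n%:R) `^ (q / p) * n%:R - N| <= N * tau.
  have h1 : `|((1 - u n) / v n) `^ (q / p) * v n - 1| <= tau.
    rewrite distrC; near: n.
    by move/cvgrPdist_le : cratio; apply.
  have -> : rho / n%:R = (1 - u n) / v n.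
    by rewrite rhoE /v -/N; field; rewrite !gt_eqF.
  have -> : (n%:R : R) = N * v n by rewrite /v -/N mulrCA divff ?mulr1// gt_eqF.
  set w := _ `^ _ in h1 *.
  have -> : w * (N * v n) - N = N * (w * v n - 1) by ring.
  by rewrite normrM (gtr0_norm N0) ler_pM2l.
have hT : 1 / 2 <= @P n [set y | `|powsum q y - n%:R * m| < n%:R * (e / 4)].
  by near: n; exact: typical_near.
apply: le_trans (spike_le n0 b0 e0 (erefl rho) rho0 hk hT).
rewrite -/N -/e' -/c.
(* Half of [h] pays for the prefactor of order 1 / N, the other half for the difference between ln
   (1 - u) and - u. *)
have h1 : expR (- (h / 2 * N `^ al)) <= c / 4 * N^-1.
  rewrite expRN -[leRHS]invrK lef_pV2 ?posrE ?expR_gt0 ?invr_gt0 ?mulr_gt0 ?invr_gt0//.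
  rewrite invfM invrK invf_div -[X in _ * X]expr1 /N.
  have := near_poly_le_expR (4 / c) 1 al_gt0 h20.
  near: n.
  by have [M _ HM] := near_poly_le_expR (4 / c) 1 al_gt0 h20; exists M => // k /= Mk _; apply: HM => /=; exact: leqW.
have h2 : expR (- (N `^ al * (L + h / 2))) <= (rho / N) `^ (n%:R / p).
  have -> : rho / N = 1 - u n by rewrite rhoE mulrAC divff ?mul1r// gt_eqF.
  (* Inverse form of 1 / (1 - u) = 1 + u / (1 - u) <= exp(u / (1 - u)). *)
  have h3 : expR (- (u n / (1 - u n))) <= 1 - u n.
    rewrite expRN -[leRHS]invrK lef_pV2 ?posrE ?expR_gt0 ?invr_gt0//.
    apply: le_trans (expR_ge1Dx _).
    by rewrite le_eqVlt; apply/orP; left; apply/eqP; field; rewrite gt_eqF.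
  have np0 : 0 <= (n%:R : R) / p by rewrite divr_ge0 ?(ltW p0)// ltW.
  apply: (@le_trans _ _ (expR (- (u n / (1 - u n))) `^ (n%:R / p))); last first.
    by apply: ge0_ler_powR; rewrite ?nnegrE ?expR_ge0// ltW.
  rewrite -expRM ler_expR mulNr lerN2.
  have h4 : L / (1 - u n) <= L + h / 2.
    rewrite -lerBlDl; apply: le_trans (ler_norm _) _; rewrite distrC; near: n.
    by move/cvgrPdist_le : cL; apply.
  have h5 : n%:R * u n <= N `^ al * b `^ al.
    have h6 : N * N `^ (al - 1) = N `^ al by rewrite mulr_powRB1// ltW.
    rewrite -h6 -mulrA (mulrC _ (b `^ al)) -/(u n) ler_wpM2r//.
    by rewrite /N ler_nat.
  apply: (@le_trans _ _ (N `^ al * (L / (1 - u n)))); last by rewrite ler_wpM2l ?powR_ge0.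
  rewrite /L [leLHS](_ : _ = n%:R * u n * (p^-1 / (1 - u n))); last by ring.
  rewrite [leRHS](_ : _ = N `^ al * b `^ al * (p^-1 / (1 - u n))); last by ring.
  by rewrite ler_wpM2r// divr_ge0 ?invr_ge0// ltW.
have -> : - (N `^ al * (b `^ al / p + h)) = - (h / 2 * N `^ al) + - (N `^ al * (L + h / 2)).
  by rewrite /L; field; rewrite gt_eqF.
by rewrite expRD; apply: ler_pM; rewrite ?expR_ge0.
Unshelve. all: by end_near. Qed.

End lower_bound.

(** * The large deviation principle *)

Section limits.
Context {R : realType}.

Lemma limn_esup_le (u : nat -> \bar R) (l : \bar R) :
  (\forall n \near \oo, (u n <= l)%E) -> (limn_esup u <= l)%E.
Proof.
move=> ul; rewrite limn_esup_lim; apply: lime_le; first exact: is_cvg_esups.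
have [N _ H] := ul; exists N => // n /= Nn.
apply: ge_ereal_sup => _ [k /= nk <-]; apply: H => /=; exact: leq_trans nk.
Qed.

Lemma limn_einf_ge (u : nat -> \bar R) (l : \bar R) :
  (\forall n \near \oo, (l <= u n)%E) -> (l <= limn_einf u)%E.
Proof.
move=> ul; rewrite /limn_einf leeNr; apply: limn_esup_le.
by near=> n; rewrite leeN2; near: n.
Unshelve. all: by end_near. Qed.

Lemma lne_speed_le (s x r : R) : 0 < s -> 0 <= x -> x <= expR (- (s * r)) ->
  ((s^-1)%:E * lne x%:E <= (- r)%:E)%E.
Proof.
move=> s0; rewrite le_eqVlt => /predU1P[<- _|x0 xr].
  rewrite le0_lneNy// gt0_muleNy ?leNye// lte_fin invr_gt0//.
rewrite lne_EFin// -EFinM lee_fin ler_pdivrMl// mulrN -(expRK (- (s * r))).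
by rewrite ler_ln// posrE expR_gt0.
Qed.

Lemma lne_speed_ge (s x r : R) : 0 < s -> expR (- (s * r)) <= x ->
  ((- r)%:E <= (s^-1)%:E * lne x%:E)%E.
Proof.
move=> s0 xr; have x0 : 0 < x by apply: lt_le_trans xr; exact: expR_gt0.
rewrite lne_EFin// -EFinM lee_fin ler_pdivlMl// mulrN -(expRK (- (s * r))).
by rewrite ler_ln// posrE expR_gt0.
Qed.

(** Testing real levels strictly below [J] treats finite and infinite [J] alike; [+oo] occurs when
    the closure of the set misses the domain of finite rate. *)
Lemma lee_oppr_approx (L J : \bar R) : (0 < J)%E ->
  (forall j : R, 0 < j -> (j%:E < J)%E -> (L <= (- j)%:E)%E) -> (L <= - J)%E.
Proof.
case: J => [j0||//] J0 H.
  rewrite lte_fin in J0; apply/lee_addgt0Pr => e e0.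
  have j1 : 0 < Num.max (j0 - e) (j0 / 2) by rewrite lt_max divr_gt0 ?orbT.
  apply: (le_trans (H _ j1 _)).
    by rewrite lte_fin gt_max gtrBl e0 ltr_pdivrMr//; lra.
  by rewrite -EFinN -EFinD lee_fin -lerN2 opprK opprD opprK le_max lexx.
case: L H => [l||//] H.
  have := H (`|l| + 1) _ (ltry _); rewrite lee_fin.
  move=> /(_ (ltr_wpDl (normr_ge0 l) ltr01)) h.
  by exfalso; have := ler_norm (- l); rewrite normrN; lra.
by have := H 1 ltr01 (ltry _).
Qed.

(** The case x = 0 matters: it is the left end of the domain of the rate, where z^q - M vanishes. *)
Lemma cvg_powR_right (x a : R) : 0 <= x -> 0 < a ->
  (x + h) `^ a @[h --> 0^'+] --> x `^ a.
Proof.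
rewrite le_eqVlt => /predU1P[<-|x0] a0.
  under eq_cvg do rewrite add0r.
  by rewrite powR0 ?gt_eqF//; exact: powR_cvg0.
apply: cvg_at_right_filter; rewrite -[X in _ --> X `^ _]addr0.
apply: (cvg_comp (fun h => x + h) (fun y => y `^ a) (G := nbhs (x + 0))).
  by apply: cvgD; [exact: cvg_cst|exact: cvg_id].
by apply: continuous_powR; rewrite addr0.
Qed.

End limits.

(** * The rate function and the two large deviation bounds *)

Section assembly.
Context {R : realType} (p q : R).
Hypotheses (p1 : 1 <= p) (pq : p < q).
Let p0 : 0 < p. Proof. exact: lt_le_trans p1. Qed.
Let q0 : 0 < q. Proof. exact: lt_trans pq. Qed.
Local Notation m := (gint p q 1 / gint p 0 1).
Local Notation al := (p / q).
Let al_gt0 : 0 < al. Proof. exact: divr_gt0. Qed.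
Let m_gt0 : 0 < m. Proof. by rewrite divr_gt0// gint_gt0// ltW. Qed.
Let qi_gt0 : 0 < q^-1. Proof. by rewrite invr_gt0. Qed.

Let powq (u : R) : 0 <= u -> (u `^ q^-1) `^ q = u.
Proof. by move=> u0; rewrite -powRrM mulVf ?gt_eqF// powRr1. Qed.

Let powqi (u : R) : 0 <= u -> (u `^ q) `^ q^-1 = u.
Proof. by move=> u0; rewrite -powRrM mulfV ?gt_eqF// powRr1. Qed.

Let powal (u : R) : 0 <= u -> (u `^ al^-1) `^ al = u.
Proof. by move=> u0; rewrite -powRrM mulVf ?gt_eqF// powRr1. Qed.

(* The rescaled point [n ^ (1 / p) * Z] lives in [pball p n], where the statistic is [qmean]. *)
Definition qmean n (y : n.-tuple R) : R := (powsum q y / n%:R) `^ q^-1.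

Lemma measurable_qmean n (A : set R) : measurable A ->
  measurable [set y : n.-tuple R | A (qmean y)].
Proof.
move=> mA; rewrite -[X in measurable X]setTI.
have : measurable_fun setT (@qmean n).
  apply: (measurableT_comp (measurable_powR q^-1)).
  by apply: measurable_funM => //; exact: measurable_powsum.
exact.
Qed.

Lemma lpballE n : @lpball R p n = pball p 1.
Proof.
apply/seteqP; split => y; rewrite /lpball/pball/lpnorm/= -/(powsum p y) => h.
  have := ler_powR2 (ltW p0) (powR_ge0 _ _) h.
  by rewrite -powRrM mulVf ?gt_eqF// powRr1 ?powsum_ge0// powR1.
have pi0 : 0 <= p^-1 by rewrite invr_ge0 ltW.
by have := ler_powR2 pi0 (powsum_ge0 p y) h; rewrite powR1.
Qed.

(** Scaling by n^(1/p) multiplies numerator and denominator by the same power, and the exponent 1/p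
    - 1/q is the one that turns the statistic into [qmean]. *)
Lemma unif_ball_probE n (A : set R) : (0 < n)%N -> measurable A ->
  unif_ball_prob p [set z : n.-tuple R | A (n%:R `^ (p^-1 - q^-1) * lpnorm q z)] =
  prob p [set y : n.-tuple R | A (qmean y)].
Proof.
move=> n0 mA; have n0' : (0 : R) < n%:R by rewrite ltr0n.
pose r := (n%:R : R) `^ p^-1; have r0 : 0 < r by rewrite powR_gt0.
have rp : r `^ p = n%:R by rewrite /r -powRrM mulVf ?gt_eqF// powRr1// ltW.
have ballE : @pball R p n 1 = [set z | pball p n%:R (scale_tuple r z)].
  have E (t : R) : (n%:R * t <= n%:R) = (t <= 1) by rewrite -[leRHS]mulr1 ler_pM2l.
  by apply/seteqP; split => z; rewrite /pball/= powsum_scale ?(ltW r0)// rp E.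
have qE (z : n.-tuple R) : n%:R `^ (p^-1 - q^-1) * lpnorm q z = qmean (scale_tuple r z).
  rewrite /qmean /lpnorm -/(powsum q z) powsum_scale ?(ltW r0)//.
  rewrite mulrAC powRM ?powsum_ge0 ?divr_ge0 ?powR_ge0// powRM ?powR_ge0 ?invr_ge0//.
  rewrite powqi ?(ltW r0)// powRV// powRD ?powRN//.
  by rewrite (gt_eqF n0') implybT.
rewrite /unif_ball_prob /prob lpballE.
set G := pball p n%:R `&` [set y | A (qmean y)].
have mD := @measurable_pball R p n n%:R.
have mG : measurable G by apply: measurableI => //; exact: measurable_qmean.
have -> : pball p 1 `&` [set z : n.-tuple R | A (n%:R `^ (p^-1 - q^-1) * lpnorm q z)] =
    [set z | G (scale_tuple r z)].
  by rewrite ballE; apply/seteqP; split => z /= [h1 h2]; split => //=; rewrite ?qE// -qE.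
have E1 := rvol_scale r0 mG.
have E2 := rvol_scale r0 mD.
rewrite ballE.
transitivity ((r^-1 ^+ n * rvol G) / (r^-1 ^+ n * rvol (pball p n%:R : set (n.-tuple R)))).
  by congr (_ / _); [exact: E1|exact: E2].
by rewrite -mulf_div divff ?mul1r// expf_neq0// invr_neq0// gt_eqF.
Qed.

Lemma prob_le1 n (F : set (n.-tuple R)) : (0 < n)%N -> measurable F -> prob p F <= 1.
Proof. by move=> n0 mF; rewrite -(probT p1 n0); exact: le_prob. Qed.

Definition rate (z : R) : \bar R :=
  if m `^ q^-1 <= z then ((z `^ q - m) `^ al / p)%:E else +oo%E.

Let z0_gt0 : 0 < m `^ q^-1. Proof. exact: powR_gt0. Qed.

Lemma rate_ge0 z : (0 <= rate z)%E.
Proof. by rewrite /rate; case: ifP => // _; rewrite lee_fin divr_ge0 ?powR_ge0// ltW. Qed.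

Lemma le_pow_z0 z : m `^ q^-1 <= z -> m <= z `^ q.
Proof.
by move=> h; have := ler_powR2 (ltW q0) (powR_ge0 _ _) h; rewrite powq// ltW.
Qed.

Lemma rate_lsc : lower_semicontinuous rate.
Proof.
move=> x a; rewrite {1}/rate; case: ifPn => [zx|]; last first.
  rewrite -ltNge => xz _; exists [set y | y < m `^ q^-1]; first exact: lt_nbhsl.
  by move=> y /= yz; rewrite /rate leNgt yz/= ltry.
rewrite lte_fin => ax; have [a0|a0] := ltP a 0.
  by exists setT; [exact: filterT|move=> y _; apply: lt_le_trans (rate_ge0 y); rewrite lte_fin].
have mx := le_pow_z0 zx.
have x0 : 0 < x by exact: lt_le_trans zx.
(* At the threshold the rate is 0, so a value a >= 0 strictly below the rate forces [x] into the
   region where the formula is continuous. *)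
have mx' : 0 < x `^ q - m.
  rewrite lt_neqAle subr_ge0 mx andbT; apply/negP => /eqP h; move: ax.
  by rewrite -h powR0 ?gt_eqF// mul0r ltNge a0.
have cg : (y `^ q - m) `^ al / p @[y --> x] --> (x `^ q - m) `^ al / p.
  apply: cvgM; last exact: cvg_cst.
  apply: (cvg_comp (fun y => y `^ q - m) (fun v => v `^ al) (G := nbhs (x `^ q - m))).
    by apply: cvgB; [exact: continuous_powR|exact: cvg_cst].
  exact: continuous_powR.
exists [set y | a < (y `^ q - m) `^ al / p]; first exact: (cvgr_gt _ cg).
by move=> y /= ay; rewrite /rate; case: ifP => _; rewrite ?lte_fin ?ltry.
Qed.

Lemma rate_good : good_rate rate.
Proof.
move=> a; have [a0|a0] := ltP a 0.
  rewrite (_ : [set _ | _] = set0); first exact: compact0.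
  apply/seteqP; split => // x /= h.
  by have := le_trans (rate_ge0 x) h; rewrite lee_fin leNgt a0.
rewrite (_ : [set _ | _] = `[m `^ q^-1, (m + (p * a) `^ al^-1) `^ q^-1]%classic).
  exact: segment_compact.
have pa0 : 0 <= p * a by rewrite mulr_ge0// ltW.
apply/seteqP; split => x /=; rewrite in_itv/= /rate; case: ifPn => //=.
- move=> zx; rewrite lee_fin ler_pdivrMr// (mulrC a) => h.
  have x0 : 0 <= x by rewrite (le_trans _ zx)// ltW.
  have mx : 0 <= x `^ q - m by rewrite subr_ge0 le_pow_z0.
  rewrite -(powqi x0); apply: ler_powR2; rewrite ?powR_ge0 ?(ltW qi_gt0)//.
  rewrite -lerBlDl.
  have ali : 0 <= al^-1 by rewrite invr_ge0 ltW.
  have := ler_powR2 ali (powR_ge0 _ _) h.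
  by rewrite -powRrM mulfV ?gt_eqF// powRr1.
- move=> zx h; rewrite lee_fin ler_pdivrMr// (mulrC a).
  have x0 : 0 <= x by rewrite (le_trans _ zx)// ltW.
  have := ler_powR2 (ltW q0) x0 h; rewrite powq; last by rewrite addr_ge0 ?powR_ge0// ltW.
  rewrite -lerBlDl => h1; rewrite -[leRHS](powal pa0).
  by apply: ler_powR2 => //; [exact: ltW|rewrite subr_ge0 le_pow_z0].
Qed.

Lemma speed_gt0 n : (0 < n)%N -> 0 < (n%:R : R) `^ al.
Proof. by move=> n0; rewrite powR_gt0// ltr0n. Qed.

(** If the infimum is 0, the bound is P <= 1. Otherwise the zero of the rate is outside the closure,
    so [A] avoids a neighbourhood of it: its points to the left fall into the lower tail, and those
    to the right have rate above [j], hence excess at least [b]. *)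
Lemma ldp_upper (A : set R) (u : nat -> \bar R) : measurable A ->
  (forall n, (0 < n)%N -> u n = ((n%:R `^ al)^-1)%:E *
      lne (prob p [set y : n.-tuple R | A (qmean y)])%:E)%E ->
  (limn_esup u <= - ereal_inf (rate @` closure A))%E.
Proof.
move=> mA uE; set J := ereal_inf _.
have J_ge0 : (0 <= J)%E.
  by apply: le_ereal_inf_tmp => _ [z _ <-]; exact: rate_ge0.
have [J0|J0] := leP J 0%E.
  have -> : J = 0%E by apply/eqP; rewrite eq_le J0.
  rewrite oppe0; apply: limn_esup_le; near=> n.
  have n0 : (0 < n)%N by near: n; exact: nbhs_infty_gt.
  rewrite uE//; have := @lne_speed_le R (n%:R `^ al) (prob p [set y : n.-tuple R | A (qmean y)]) 0.
  rewrite oppr0; apply; [exact: speed_gt0|exact: prob_ge0|].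
  by rewrite mulr0 oppr0 expR0 prob_le1//; exact: measurable_qmean.
have z0A : ~ closure A (m `^ q^-1).
  move=> cA; have : (J <= rate (m `^ q^-1))%E by apply: ereal_inf_lbound; exists (m `^ q^-1).
  rewrite /rate lexx powq ?(ltW m_gt0)// subrr powR0 ?gt_eqF// mul0r.
  by rewrite leNgt J0.
have [e e0 He] : exists2 e : R, 0 < e & forall z, A z -> e <= `|m `^ q^-1 - z|.
  apply: contrapT => h; apply: z0A => B /nbhs_ballP[e /= e0 eB].
  apply: contrapT => AB; apply: h; exists e => // z Az.
  rewrite leNgt; apply/negP => ze; apply: AB; exists z; split => //.
  exact: eB.
apply: lee_oppr_approx => // j j0 jJ.
apply/lee_addgt0Pr => h h0.
rewrite -EFinD -[X in (_ <= X%:E)%E]opprK opprD opprK.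
(* The cap at half of the threshold keeps [z1] positive. *)
pose e' := Num.min e (m `^ q^-1 / 2).
have e'0 : 0 < e' by rewrite lt_min e0 divr_gt0.
pose z1 := m `^ q^-1 - e'.
have z1_gt0 : 0 < z1.
  by rewrite subr_gt0 gt_min; apply/orP; right; rewrite ltr_pdivrMr// ltr_pMr// ltr1n.
pose d := m - z1 `^ q.
have d0 : 0 < d.
  rewrite subr_gt0 -[ltRHS](powq (ltW m_gt0)).
  by apply: gt0_ltr_powR; rewrite ?nnegrE ?powR_ge0 ?(ltW z1_gt0)// gtrBl.
have pj0 : 0 < p * j by rewrite mulr_gt0.
pose b := (p * j) `^ al^-1; have b0 : 0 < b by rewrite powR_gt0.
have bE : b `^ al / p = j by rewrite powal ?ltW// (mulrC p) mulfK// gt_eqF.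
have h20 : 0 < h / 2 by rewrite divr_gt0.
apply: limn_esup_le; near=> n.
have n0 : (0 < n)%N by near: n; exact: nbhs_infty_gt.
have n0' : (0 : R) < n%:R by rewrite ltr0n.
have hL : @prob R p n [set y | powsum q y <= n%:R * (m - d)] <= expR (- (j * n%:R `^ al)).
  by near: n; exact: lower_tail_near.
have hU : @prob R p n [set y | n%:R * (m + b) <= powsum q y] <=
    expR (- (n%:R `^ al * (b `^ al / p - h / 2))).
  by near: n; exact: upper_tail_near.
(* Makes exp(s h / 2) at least 2 for the speed s, which absorbs the factor 2 of the union bound. *)
have hn : 2 / h <= n%:R `^ al by near: n; exact: near_powR_ge.
rewrite uE//; apply: lne_speed_le; [exact: speed_gt0|exact: prob_ge0|].
have mL : measurable [set y : n.-tuple R | powsum q y <= n%:R * (m - d)].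
  exact: (@measurable_pball R q n).
have mU : measurable [set y : n.-tuple R | n%:R * (m + b) <= powsum q y].
  rewrite (_ : [set _ | _] = [set y : n.-tuple R | `[n%:R * (m + b), +oo[%classic (powsum q y)]).
    by apply: measurable_powsum_preimage; exact: measurable_itv.
  by apply/seteqP; split => y; rewrite /= in_itv/= andbT.
have cover : [set y : n.-tuple R | A (qmean y)] `<=`
    [set y | powsum q y <= n%:R * (m - d)] `|` [set y | n%:R * (m + b) <= powsum q y].
  move=> y /= Ay; set s := powsum q y.
  have sn0 : 0 <= s / n%:R by rewrite divr_ge0 ?powsum_ge0.
  have x0 : 0 <= qmean y by exact: powR_ge0.
  have sE : s = n%:R * (qmean y `^ q) by rewrite powq// mulrC divfK// gt_eqF.
  have [xz1|xz1] := leP (qmean y) z1.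
    left; rewrite sE /d subKr ler_pM2l//.
    by apply: ler_powR2 => //; exact: ltW.
  right; rewrite sE ler_pM2l//.
  have zx : m `^ q^-1 <= qmean y.
    have := He _ Ay; rewrite leNgt => /negP; apply: contra_notP => /negP.
    rewrite -ltNge => xz; rewrite gtr0_norm ?subr_gt0//.
    have e'e : e' <= e by rewrite ge_min lexx.
    rewrite ltrBlDl -ltrBlDr; apply: le_lt_trans xz1.
    by rewrite /z1 lerD2l lerN2.
  rewrite leNgt; apply/negP => xb.
  have : (J <= rate (qmean y))%E.
    by apply: ereal_inf_lbound; exists (qmean y) => //; exact: subset_closure.
  rewrite leNgt => /negP; apply; apply: le_lt_trans jJ.
  rewrite /rate zx lee_fin -bE ler_pM2r ?invr_gt0//.
  apply: ler_powR2; [exact: ltW|by rewrite subr_ge0 le_pow_z0|].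
  by rewrite lerBlDl ltW.
have mQ := @measurable_qmean n A mA.
have hc := le_prob p1 mQ (measurableU _ _ mL mU) cover.
apply: (le_trans hc).
apply: (le_trans (probU_le p1 mL mU)).
apply: (le_trans (lerD hL hU)); rewrite bE.
have s0 := speed_gt0 n0.
move: (n%:R `^ al) hn s0 => s hn s0.
have h1 : 1 <= s * (h / 2).
  by move: hn; rewrite ler_pdivrMr// => hn; lra.
apply: (@le_trans _ _ (2 * expR (- (s * (j - h / 2))))).
  rewrite mulr_natl mulr2n lerD2r ler_expR lerN2 mulrBr (mulrC j).
  by rewrite gerBl mulr_ge0 ?ltW.
have h2 : 2 <= expR (s * (h / 2)) by apply: le_trans (expR_ge1Dx _); lra.
apply: (le_trans (ler_wpM2r (expR_ge0 _) h2)).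
rewrite -expRD ler_expR; lra.
Unshelve. all: by end_near. Qed.

(** The local lower bound requires a strictly positive excess, which fails at the left end of the
    domain. The point z is therefore moved slightly to the right inside the interior of [A], and
    right continuity of the rate limits the cost to h / 2. *)
Lemma ldp_lower (A : set R) (u : nat -> \bar R) : measurable A ->
  (forall n, (0 < n)%N -> u n = ((n%:R `^ al)^-1)%:E *
      lne (prob p [set y : n.-tuple R | A (qmean y)])%:E)%E ->
  (- ereal_inf (rate @` interior A) <= limn_einf u)%E.
Proof.
move=> mA uE; rewrite leeNl; apply: le_ereal_inf_tmp => _ [z Az <-].
rewrite /rate; case: ifPn => [zz|_]; last exact: leey.
have mz := le_pow_z0 zz.
have z_gt0 : 0 < z by exact: lt_le_trans zz.
set g := _ / p.
apply/lee_addgt0Pr => h h0; rewrite -EFinD leeNl -EFinN.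
have h20 : 0 < h / 2 by rewrite divr_gt0.
have c1 : (z `^ q + t) `^ q^-1 @[t --> 0^'+] --> z.
  by have := cvg_powR_right (powR_ge0 z q) qi_gt0; rewrite powqi// ltW.
have c2 : ((z `^ q - m) + t) `^ al / p @[t --> 0^'+] --> g.
  by apply: cvgM; [apply: cvg_powR_right => //; rewrite subr_ge0|exact: cvg_cst].
have [t [t0 At gt]] : exists t, [/\ 0 < t, interior A ((z `^ q + t) `^ q^-1) &
    ((z `^ q - m) + t) `^ al / p < g + h / 2].
  have near0 : \forall t \near 0^'+, 0 < t :> R by exact: nbhs_right_gt.
  have nearA : \forall t \near 0^'+, interior A ((z `^ q + t) `^ q^-1).
    have zA : nbhs z (interior A).
      by apply: open_nbhs_nbhs; split => //; exact: open_interior.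
    exact: (c1 _ zA).
  have nearg : \forall t \near 0^'+, ((z `^ q - m) + t) `^ al / p < g + h / 2.
    by apply: (cvgr_lt _ c2); rewrite ltrDl.
  have : \forall t \near 0^'+, [/\ 0 < t, interior A ((z `^ q + t) `^ q^-1) &
      ((z `^ q - m) + t) `^ al / p < g + h / 2].
    by near=> t; split; near: t.
  by move=> /filter_ex.
pose b := z `^ q - m + t; have b0 : 0 < b by rewrite ltr_wpDl// subr_ge0.
have mb : z `^ q + t = m + b by rewrite /b; ring.
rewrite mb in At.
have mb0 : 0 < m + b by rewrite addr_gt0.
have [e e0 He] : exists2 e : R, 0 < e & forall v, `|v - (m + b)| < e -> A (v `^ q^-1).
  have H : v `^ q^-1 @[v --> m + b] --> (m + b) `^ q^-1 by exact: continuous_powR.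
  have := H A At => /nbhs_ballP[e /= e0 eB]; exists e => // v ve.
  by apply: eB; rewrite /ball/= distrC.
apply: limn_einf_ge; near=> n.
have n0 : (0 < n)%N by near: n; exact: nbhs_infty_gt.
have n0' : (0 : R) < n%:R by rewrite ltr0n.
have hB : expR (- (n%:R `^ al * (b `^ al / p + h / 2))) <=
    @prob R p n [set y | `|powsum q y - n%:R * (m + b)| < n%:R * e].
  by near: n; exact: lower_bound_near.
rewrite uE//; apply: lne_speed_ge; first exact: speed_gt0.
apply: (@le_trans _ _ (expR (- (n%:R `^ al * (b `^ al / p + h / 2))))).
  rewrite ler_expR lerN2 ler_wpM2l ?powR_ge0//.
  by move: gt; rewrite -/b; lra.
apply: (le_trans hB); apply: (le_prob p1).
- exact: measurable_near_mean.
- exact: measurable_qmean.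
- move=> y /= hy; apply: He.
  have -> : powsum q y / n%:R - (m + b) = (powsum q y - n%:R * (m + b)) / n%:R.
    by rewrite mulrBl (mulrC n%:R) mulfK// gt_eqF.
  by rewrite normrM normfV (gtr0_norm n0') ltr_pdivrMr// [ltRHS]mulrC.
Unshelve. all: by end_near. Qed.

End assembly.

Theorem theorem1p3 (R : realType) (p q : R) (hp1 : 1 <= p) (hpq : p < q) :
  let law := fun (n : nat) (A : set R) =>
    unif_ball_prob p [set z : n.-tuple R |
      A (n%:R `^ (p^-1 - q^-1) * lpnorm q z)] in
  let I := fun z : R =>
    if Mp p q `^ q^-1 <= z then ((z `^ q - Mp p q) `^ (p / q) / p)%:E
    else +oo%E in
  LDP law (fun n => n%:R `^ (p / q)) I /\ good_rate I.
Proof.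
have p0 : 0 < p by exact: lt_le_trans hp1.
have q0 : 0 < q by exact: lt_trans hpq.
cbv zeta; rewrite Mp_gint ?(ltW q0)//.
split; last exact: (rate_good hp1 hpq).
split; first exact: rate_ge0.
split; first exact: (rate_lsc hp1 hpq).
move=> A mA; cbv zeta.
set u := fun n : nat => _.
have uE n : (0 < n)%N -> u n = (((n%:R `^ (p / q))^-1)%:E *
    lne (prob p [set y : n.-tuple R | A (qmean q y)])%:E)%E.
  by move=> n0; rewrite /u unif_ball_probE.
split; [exact: ldp_lower|exact: limn_einf_sup|exact: ldp_upper].
Qed.
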